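(* Let $M^n$ be a compact $f$-minimal hypersurface immersed in the cylinder shrinking Ricci soliton $\mathbb{R}^{n-k+1}\times S^k_{\sqrt{2(k-1)}}(0)$, where $n\ge 3$ and $2\le k\le n-1$. If $$H\le\frac{\sqrt{2(n-k)}}{2},$$ then $M^n=S^{n-k}_r(0)\times S^k_{\sqrt{2(k-1)}}(0)$, where $r=\sqrt{2(n-k)}$.
   Context: The cylinder shrinking Ricci soliton is $\bar M^{n+1}=\mathbb{R}^{n+1-k}\times S^k_{\sqrt{2(k-1)}}(0)$ with the product metric and potential function $f(x,y)=|x|^2/4$, where $x$ is the position vector in $\mathbb{R}^{n+1-k}$, $y$ is the position vector in $\mathbb{R}^{k+1}$, and $S^m_\rho(0)\subset\mathbb{R}^{m+1}$ is the round sphere of radius $\rho$ centered at $0$. $M^n$ is an oriented hypersurface with unit normal vector $N$; $\bar\nabla$ is the Riemannian connection of $\bar M^{n+1}$; the second fundamental form is $A(u,v)=\langle\bar\nabla_uv,N\rangle$; the mean curvature vector is $\vec H=(\mathrm{tr}_{M^n}A)N$ and the mean curvature $H$ is given by $\vec H=-HN$; the weighted mean curvature vector is $\vec H_f=\vec H+(\bar\nabla f)^\perp$, where $\perp$ is the projection to the normal bundle, and the weighted mean curvature $H_f$ is given by $\vec H_f=-H_fN$, so $H_f=H-\langle\bar\nabla f,N\rangle$. $M^n$ is $f$-minimal if $H_f=0$.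
   Formalization: M is taken connected and N is assumed to point outward at some point farthest from {0}×S^k (for arbitrary N the claim fails, e.g. Abresch–Langer curve × S^k with N inward); M = product means equality of the image, with the immersion injective when n−k ≥ 2 (circle covers occur when k = n−1). *)

(* Defs.v *)
(* MathComp / MathComp-Analysis, over an arbitrary real type R *)
From HB Require Import structures.
From mathcomp Require Import all_boot all_order all_algebra.
From mathcomp Require Import all_classical all_reals all_analysis.

Set Implicit Arguments.
Unset Strict Implicit.
Unset Printing Implicit Defensive.

Import Order.TTheory GRing.Theory Num.Theory.
Import numFieldNormedType.Exports.

Local Open Scope classical_set_scope.
Local Open Scope ring_scope.

Section Euclidean.
Context {R : realType}.

(* The library norm on 'rV[R]_m is the sup norm; the Euclidean inner product
   and norm are the following ones. *)
Definition dot {m : nat} (u v : 'rV[R]_m) : R := \sum_(i < m) u 0 i * v 0 i.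
Definition enorm {m : nat} (u : 'rV[R]_m) : R := Num.sqrt (dot u u).
Definition sphere (m : nat) (r : R) : set 'rV[R]_m := [set u | enorm u = r].

(* Directional derivative along the i-th vector of the standard basis. *)
Definition partial {m : nat} {W : normedModType R} (i : 'I_m)
  (f : 'rV[R]_m -> W) : 'rV[R]_m -> W := 'D_(delta_mx 0 i) f.

(* Meaningful for U open. *)
Fixpoint Ck {m : nat} {W : normedModType R} (r : nat) (U : set 'rV[R]_m)
    (f : 'rV[R]_m -> W) : Prop :=
  if r is r'.+1 then
    (forall u, U u -> differentiable f u) /\
    (forall i : 'I_m, Ck r' U (partial i f))
  else forall u, U u -> {for u, continuous f}.

Definition Cinfty {m : nat} {W : normedModType R} (U : set 'rV[R]_m)
  (f : 'rV[R]_m -> W) : Prop := forall r, Ck r U f.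

End Euclidean.
Arguments sphere {R} m r.

Section Manifold.
Context {R : realType} {n : nat} {M : topologicalType}.

(* A local parametrization and its inverse, as total functions that are
   constrained only on the open sets dom and cod respectively. *)
Record chart := Chart {
  dom : set 'rV[R]_n;
  cod : set M;
  param : 'rV[R]_n -> M;
  coord : M -> 'rV[R]_n;
  dom_open : open dom;
  cod_open : open cod;
  param_cod : forall u, dom u -> cod (param u);
  coord_dom : forall p, cod p -> dom (coord p);
  paramK : forall u, dom u -> coord (param u) = u;
  coordK : forall p, cod p -> param (coord p) = p;
  param_continuous : forall u, dom u -> {for u, continuous param};
  coord_continuous : forall p, cod p -> {for p, continuous coord} }.

Record smooth_atlas := SmoothAtlas {
  charts : set chart;
  charts_cover : forall p, exists2 c, charts c & cod c p;
  charts_compatible : forall c c', charts c -> charts c' ->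
    Cinfty (dom c `&` param c @^-1` cod c') (coord c' \o param c) }.

Definition smooth_map {W : normedModType R} (A : smooth_atlas) (F : M -> W) :=
  forall c, charts A c -> Cinfty (dom c) (F \o param c).

End Manifold.
Arguments chart : clear implicits.
Arguments smooth_atlas : clear implicits.

Section Hypersurface.
Context {R : realType} {a b : nat}.
Local Notation E := ('rV[R]_a * 'rV[R]_b)%type.

(* R^a x R^b as one Euclidean space; cylinder rho inherits from it the product
   metric of R^a x S^(b-1)_rho. *)
Definition dotE (v w : E) : R := dot v.1 w.1 + dot v.2 w.2.

Definition cylinder (rho : R) : set E := [set: 'rV[R]_a] `*` sphere b rho.

(* Tangent space at q of the cylinder through q, and the orthogonal
   projection onto it. *)
Definition cyl_tangent (q : E) : set E := [set w | dot w.2 q.2 = 0].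
Definition cyl_proj (q w : E) : E :=
  (w.1, w.2 - (dot w.2 q.2 / dot q.2 q.2) *: q.2).

(* Gradient on the cylinder of the restriction of F. *)
Definition cyl_grad (F : E -> R) (q : E) : E :=
  cyl_proj q (\row_i 'D_((delta_mx 0 i, 0) : E) F q,
              \row_j 'D_((0, delta_mx 0 j) : E) F q).

Definition potential (q : E) : R := enorm q.1 ^+ 2 / 4.

Context {n : nat} {M : topologicalType}.

Definition immersion_in_cylinder (A : smooth_atlas R n M) (rho : R)
    (X : M -> E) : Prop :=
  [/\ smooth_map A X,
      forall p, cylinder rho (X p) &
      forall c u, charts A c -> dom c u -> injective ('d (X \o param c) u)].

Definition unit_normal_field (A : smooth_atlas R n M) (X N : M -> E) : Prop :=
  [/\ smooth_map A N,
      forall p, cyl_tangent (X p) (N p),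
      forall p, dotE (N p) (N p) = 1 &
      forall c u v, charts A c -> dom c u ->
        dotE (N (param c u)) ('d (X \o param c) u v) = 0].

Variables (X N : M -> E) (c : chart R n M) (u : 'rV[R]_n).
Let p : M := param c u.

(* What follows is computed at p = param c u in the coordinate frame of the
   chart c; curvature vectors and scalars do not depend on the chart. *)

Definition frame (i : 'I_n) : 'rV[R]_n -> E := partial i (X \o param c).

(* The Levi-Civita connection of the cylinder, along the i-th coordinate
   field, for a field V along the chart: tangential part of the flat
   derivative. *)
Definition cyl_connection (i : 'I_n) (V : 'rV[R]_n -> E) : E :=
  cyl_proj (X p) (partial i V u).

Definition first_form : 'M[R]_n := \matrix_(i, j) dotE (frame i u) (frame j u).
Definition second_form : 'M[R]_n :=
  \matrix_(i, j) dotE (cyl_connection i (frame j)) (N p).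

Definition mean_curvature_vector : E :=
  \tr (invmx first_form *m second_form) *: N p.

(* N is a unit vector, so this is the H such that the mean curvature vector
   is - H N; likewise for the weighted one. *)
Definition mean_curvature : R := - dotE mean_curvature_vector (N p).

Definition weighted_mean_curvature_vector (F : E -> R) : E :=
  mean_curvature_vector + dotE (cyl_grad F (X p)) (N p) *: N p.

Definition weighted_mean_curvature (F : E -> R) : R :=
  - dotE (weighted_mean_curvature_vector F) (N p).

End Hypersurface.

Definition f_minimal {R : realType} {a b n : nat} {M : topologicalType}
    (A : smooth_atlas R n M) (X N : M -> 'rV[R]_a * 'rV[R]_b) : Prop :=
  forall c u, charts A c -> dom c u ->
    weighted_mean_curvature X N c u potential = 0.

(* The unit normal of a hypersurface is determined only up to sign, and H
   changes sign with it. This fixes the sign: at some point where the distance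
   to {0} x S^(b-1) is maximal, N points away from {0} x S^(b-1). At any
   such point N or - N does, so this is a choice of orientation and no
   restriction on the immersion. *)
Definition outward_oriented {R : realType} {a b : nat} {M : Type}
    (X N : M -> 'rV[R]_a * 'rV[R]_b) : Prop :=
  exists p, (forall q, enorm (X q).1 <= enorm (X p).1) /\
            0 <= dot (X p).1 (N p).1.

(* Main.v *)
Require Import Defs.
From HB Require Import structures.
From mathcomp Require Import all_boot all_order all_algebra.
From mathcomp Require Import all_classical all_reals all_analysis.
From mathcomp Require Import ring lra zify.
Import Order.TTheory GRing.Theory Num.Theory.
Import numFieldNormedType.Exports.
Local Open Scope classical_set_scope.
Local Open Scope ring_scope.

Set Implicit Arguments.
Unset Strict Implicit.
Unset Printing Implicit Defensive.

(** Write a = n - k + 1 and b = k + 1, let x and y be the two components of the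
    immersion X in R^a x R^b, and N1 the component of N in R^a. Since the gradient
    of |x|^2 / 4 is x / 2, f-minimality says H = <x, N1> / 2
    ([f_minimal_mean_curvature]).

    The length of x. Tracing the second derivatives of |x|^2 / 2 over the tangent
    space gives its Laplacian on M,
      a - |N1|^2 - <x, N1>^2 / 2                       ([laplace_defect]).
    At a point where |x| is maximal, x is normal to M, so H = |x| / 2 for the
    outward orientation and the bound on H yields |x|^2 <= 2 (a - 1) at that point,
    hence everywhere. By the Cauchy-Schwarz inequality the Laplacian is then at
    least a (1 - |N1|^2) >= 0. At the maximum it is a - 1 - |x|^2 / 2 <= 0, so that
    |x|^2 = 2 (a - 1) there. Thus a subharmonic function attains its maximum, and
    Hopf's strong maximum principle ([hopf_contact], [strong_minimum_principle],
    applied to the defect a - 1 - |x|^2 / 2) shows that |x|^2 = 2 (a - 1) on all of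
    the connected M ([radius_constant]).

    The image. X is now an immersion of the n-dimensional M into the n-dimensional
    product of spheres S^(a-1) x S^(b-1). It is locally injective by the mean value
    theorem ([locally_injective]), and open because the point of a small closed
    neighborhood whose image is nearest to a given point q of the product can
    differ from q only by a normal vector ([locally_open]).
    On a compact M these two properties make X a covering. Its homotopy lifting
    property is proved by small steps in time, uniformly over the whole domain
    ([lift_step], [lift_homotopy]). A sphere is covered by two caps that contract
    to their centres, so a lift over one point of a sphere extends to both caps; if
    the sphere has dimension at least 2, the caps meet in a connected set and the
    two extensions agree there ([sphere_lift]).
    Reaching all directions in both factors gives surjectivity; when both factors
    have dimension at least 2 one obtains a continuous section of X, and the
    connectedness of M makes it the inverse of X. *)

(** * Euclidean inner product and Gram matrices *)

Section Dot.
Context {R : realType} {m : nat}.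
Implicit Types u v w : 'rV[R]_m.

Lemma dot_mulmx u v : dot u v = (u *m v^T) 0 0.
Proof. by rewrite mxE; apply: eq_bigr => i _; rewrite mxE. Qed.

Lemma dotC u v : dot u v = dot v u.
Proof. by apply: eq_bigr => i _; rewrite mulrC. Qed.

Lemma dotDl u v w : dot (u + v) w = dot u w + dot v w.
Proof. by rewrite !dot_mulmx mulmxDl mxE. Qed.

Lemma dotDr u v w : dot w (u + v) = dot w u + dot w v.
Proof. by rewrite !(dotC w) dotDl. Qed.

Lemma dotZl k u v : dot (k *: u) v = k * dot u v.
Proof. by rewrite !dot_mulmx -scalemxAl mxE. Qed.

Lemma dotZr k u v : dot u (k *: v) = k * dot u v.
Proof. by rewrite dotC dotZl dotC. Qed.

Lemma dotNl u v : dot (- u) v = - dot u v.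
Proof. by rewrite -scaleN1r dotZl mulN1r. Qed.

Lemma dotNr u v : dot u (- v) = - dot u v.
Proof. by rewrite dotC dotNl dotC. Qed.

Lemma dotBl u v w : dot (u - v) w = dot u w - dot v w.
Proof. by rewrite dotDl dotNl. Qed.

Lemma dotBr u v w : dot w (u - v) = dot w u - dot w v.
Proof. by rewrite dotDr dotNr. Qed.

Lemma dot0l u : dot 0 u = 0.
Proof. by rewrite dot_mulmx mul0mx mxE. Qed.

Lemma dot0r u : dot u 0 = 0.
Proof. by rewrite dotC dot0l. Qed.

Lemma dot_suml I (s : seq I) (P : pred I) (F : I -> 'rV[R]_m) v :
  dot (\sum_(i <- s | P i) F i) v = \sum_(i <- s | P i) dot (F i) v.
Proof.
by elim/big_rec2: _ => [|i y1 y2 _ <-]; rewrite ?dot0l // dotDl.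
Qed.

Lemma dot_sumr I (s : seq I) (P : pred I) (F : I -> 'rV[R]_m) v :
  dot v (\sum_(i <- s | P i) F i) = \sum_(i <- s | P i) dot v (F i).
Proof. by rewrite dotC dot_suml; apply: eq_bigr => i _; rewrite dotC. Qed.

Lemma dot_ge0 u : 0 <= dot u u.
Proof. by apply: sumr_ge0 => i _; rewrite -expr2 sqr_ge0. Qed.

Lemma dot_eq0 u : (dot u u == 0) = (u == 0).
Proof.
apply/eqP/eqP => [|->]; last by rewrite dot0l.
move=> /psumr_eq0P u0; apply/rowP => i; rewrite mxE; apply/eqP.
by rewrite -[_ == 0]orbb -mulf_eq0 u0 // => j _; rewrite -expr2 sqr_ge0.
Qed.

Lemma dot_gt0 u : (0 < dot u u) = (u != 0).
Proof. by rewrite lt_neqAle dot_ge0 andbT eq_sym dot_eq0. Qed.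

(** The squared length of |v|^2 u - <u, v> v is nonnegative; divide by |v|^2. *)
Lemma cauchy_schwarz u v : dot u v ^+ 2 <= dot u u * dot v v.
Proof.
have [->|v0] := eqVneq v 0; first by rewrite !dot0r expr0n mulr0.
have vp : 0 < dot v v by rewrite dot_gt0.
have := dot_ge0 (dot v v *: u - dot u v *: v).
rewrite !(dotBl, dotBr, dotZl, dotZr) (dotC v u) => h.
rewrite -subr_ge0 -(pmulr_rge0 _ vp); apply: le_trans h _.
by rewrite le_eqVlt; apply/orP; left; apply/eqP; ring.
Qed.

Lemma enormK u : enorm u ^+ 2 = dot u u.
Proof. by rewrite sqr_sqrtr // dot_ge0. Qed.

Lemma dot_coord_le u i : u 0 i ^+ 2 <= dot u u.
Proof.
rewrite /dot (bigD1 i) //= -expr2 lerDl; apply: sumr_ge0 => j _.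
by rewrite -expr2 sqr_ge0.
Qed.

End Dot.

Lemma dot_delta {R : realType} m (u : 'rV[R]_m) i : dot u (delta_mx 0 i) = u 0 i.
Proof.
rewrite /dot (bigD1 i) //= mxE !eqxx mulr1 big1 ?addr0 // => j ji.
by rewrite mxE (negPf ji) andbF mulr0.
Qed.

Section Gram.
Context {R : realType}.

Lemma dot_mulmxl m n (u : 'rV[R]_m) (A : 'M[R]_(m, n)) (v : 'rV[R]_n) :
  dot (u *m A) v = dot u (v *m A^T).
Proof. by rewrite !dot_mulmx trmx_mul trmxK mulmxA. Qed.

Lemma dot_row_mx m n (u u' : 'rV[R]_m) (v v' : 'rV[R]_n) :
  dot (row_mx u v) (row_mx u' v') = dot u u' + dot v v'.
Proof. by rewrite !dot_mulmx tr_row_mx mul_row_col mxE. Qed.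

Lemma mx11_mul n (A : 'rV[R]_n) (B : 'rV[R]_n) : A *m B^T = (dot A B)%:M.
Proof. by rewrite dot_mulmx -mx11_scalar. Qed.

Lemma gram_coef m n (B : 'M[R]_(m, n)) i j :
  (B *m B^T) i j = dot (row i B) (row j B).
Proof. by rewrite (rowE j) dotC dot_mulmxl dotC dot_delta -row_mul [RHS]mxE. Qed.

Lemma trace_mul_gram m n (P : 'M[R]_m) (B : 'M[R]_(m, n)) :
  \tr (P *m (B *m B^T)) = \sum_i \sum_j P i j * dot (row j B) (row i B).
Proof.
apply: eq_bigr => i _; rewrite mxE; apply: eq_bigr => j _.
by rewrite gram_coef.
Qed.

(** Block Gaussian elimination on the first coordinate: the Schur complement of
    a positive definite matrix is again positive definite. The rows of Q are an
    orthonormal basis for the inner product G. *)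
Lemma posdef_orthonormalize n (G : 'M[R]_n) : G^T = G ->
  (forall u : 'rV[R]_n, u != 0 -> 0 < dot (u *m G) u) ->
  exists Q : 'M[R]_n, Q *m G *m Q^T = 1%:M.
Proof.
elim: n G => [|n IHn] G; first by move=> _ _; exists 0; apply/matrixP => -[].
rewrite -[n.+1]/(1 + n)%N in G *.
move=> Gsym Gpos.
pose g := G 0 0; pose r : 'rV[R]_n := ursubmx G; pose D : 'M[R]_n := drsubmx G.
have GE : G = block_mx g%:M r r^T D.
  rewrite -[LHS](submxK G) /D /r; congr block_mx.
    by rewrite [LHS]mx11_scalar !mxE /g; congr (G _ _)%:M; apply/val_inj.
  by rewrite -[in LHS]Gsym trmx_ursub.
have Dsym : D^T = D by rewrite /D trmx_drsub Gsym.
have gE (s : R) (v : 'rV[R]_n) : dot (row_mx s%:M v *m G) (row_mx s%:M v) =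
   s ^+ 2 * g + 2 * s * dot r v + dot (v *m D) v.
  rewrite GE mul_row_block dot_row_mx !dotDl.
  rewrite -!scalar_mxM !mul_scalar_mx !dotZl.
  rewrite [X in X + _ + _]/dot big_ord1 !mxE /= mulr1n.
  have -> : dot (v *m r^T) (s%:M : 'rV_1) = s * dot r v.
    rewrite mx11_mul /dot big_ord1 !mxE /= !mulr1n mulrC; congr (_ * _).
    exact: dotC.
  by ring.
have g0 : 0 < g.
  have := Gpos (row_mx 1%:M 0); rewrite gE dot0r mul0mx dot0l.
  rewrite expr1n mul1r mulr0 !addr0; apply.
  by apply/eqP => /rowP /(_ 0); rewrite !mxE; case: splitP => // j _;
    rewrite !mxE ord1 => /eqP; rewrite oner_eq0.
pose S := D - g^-1 *: (r^T *m r).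
have SE v : dot (v *m S) v = dot (v *m D) v - g^-1 * dot r v ^+ 2.
  rewrite /S mulmxBr dotBl -scalemxAr dotZl mulmxA mx11_mul mul_scalar_mx dotZl.
  by rewrite expr2 (dotC v r).
have [|v v0|Q QE] := IHn S.
- by rewrite /S !linearB linearZ /= Dsym trmx_mul trmxK.
- have := Gpos (row_mx (- g^-1 * dot r v)%:M v).
  have -> : row_mx (- g^-1 * dot r v)%:M v != 0.
    apply: contraNneq v0 => h; apply/eqP.
    by rewrite -[v](row_mxKr (- g^-1 * dot r v)%:M) h linear0.
  rewrite gE SE => /(_ isT); congr (_ < _).
  by field; rewrite gt_eqF.
exists (block_mx (Num.sqrt g)^-1%:M 0 (- g^-1 *: (Q *m r^T)) Q).
have sg : Num.sqrt g ^+ 2 = g by rewrite sqr_sqrtr // ltW.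
have sg0 : Num.sqrt g != 0 by rewrite gt_eqF // sqrtr_gt0.
rewrite GE tr_block_mx trmx0 !linearZ /= trmx_mul trmxK tr_scalar_mx.
rewrite !mulmx_block !mul0mx !mulmx0 !addr0.
rewrite -!(scalemxAl, scalemxAr) !mul_scalar_mx !mul_mx_scalar.
rewrite !scalerA mulNr mulVf ?gt_eqF // scaleN1r addNr scaler0.
rewrite scalar_mx_block; congr block_mx.
- rewrite scale_scalar_mx; congr (_%:M).
  by rewrite -{3}sg; field.
- rewrite -!scalemxAl mul_scalar_mx !scalerA -scalerDl.
  rewrite (_ : _ + _ = 0) ?scale0r //.
  by field; rewrite sg0 gt_eqF.
- by rewrite mul0mx scaler0 add0r -QE /S mulmxBr -scalemxAr mulmxA
    scaleNr addrC.
Qed.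

(** The quadratic form of F F^T at u is |u F|^2. *)
Lemma gram_posdef m n (F : 'M[R]_(m, n)) :
  (forall v : 'rV_m, v *m F = 0 -> v = 0) ->
  forall u : 'rV_m, u != 0 -> 0 < dot (u *m (F *m F^T)) u.
Proof.
move=> Finj u; rewrite mulmxA dot_mulmxl trmxK dot_gt0.
by apply: contra_neq => /Finj.
Qed.

Lemma gram_unit m n (F : 'M[R]_(m, n)) :
  (forall v : 'rV_m, v *m F = 0 -> v = 0) -> F *m F^T \in unitmx.
Proof.
move=> Finj; rewrite -row_free_unit; apply: inj_row_free => v vF.
apply/eqP; rewrite -[_ == _]negbK; apply/negP => /(gram_posdef Finj).
by rewrite vF dot0l ltxx.
Qed.

(** The rows of F together with e1 and e2 span the whole space, since their number
    is d. The left-hand side fixes each of them, hence it is the identity. *)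
Lemma frame_completeness n d (F : 'M[R]_(n, d)) (e1 e2 : 'rV[R]_d) :
  d = n.+2 -> (forall v : 'rV_n, v *m F = 0 -> v = 0) ->
  dot e1 e1 = 1 -> dot e2 e2 = 1 -> dot e1 e2 = 0 ->
  F *m e1^T = 0 -> F *m e2^T = 0 ->
  F^T *m invmx (F *m F^T) *m F + e1^T *m e1 + e2^T *m e2 = 1%:M.
Proof.
move=> dE Finj e11 e22 e12 Fe1 Fe2.
have mul3 (u : 'rV_d) : u *m (e1^T *m e1) = dot u e1 *: e1 /\
    u *m (e2^T *m e2) = dot u e2 *: e2.
  by split; rewrite mulmxA mx11_mul mul_scalar_mx.
have e1F : e1 *m F^T = 0 by rewrite -[LHS]trmxK trmx_mul trmxK Fe1 trmx0.
have e2F : e2 *m F^T = 0 by rewrite -[LHS]trmxK trmx_mul trmxK Fe2 trmx0.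
pose B : 'M[R]_(n + (1 + 1), d) := col_mx F (col_mx e1 e2).
set P := (X in X = _).
have BP : B *m P = B.
  rewrite /B !mul_col_mx; congr col_mx; [|congr col_mx].
  - rewrite /P !mulmxDr 2!mulmxA mulmxV ?gram_unit // mul1mx.
    by rewrite !(mulmxA F) Fe1 Fe2 !mul0mx !addr0.
  - by rewrite /P !mulmxDr (mul3 _).1 (mul3 _).2 !mulmxA e1F e11 e12 !mul0mx
      scale1r scale0r add0r addr0.
  - by rewrite /P !mulmxDr (mul3 _).1 (mul3 _).2 !mulmxA e2F dotC e12 e22
      !mul0mx scale1r scale0r !add0r.
have Bfree : row_free B.
  apply: inj_row_free => v; rewrite -[v]hsubmxK; set v1 := lsubmx v.
  rewrite -[rsubmx v]hsubmxK [lsubmx _]mx11_scalar [rsubmx (rsubmx v)]mx11_scalar.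
  set s := lsubmx _ 0 0; set t := rsubmx (rsubmx v) 0 0.
  rewrite !mul_row_col !mul_scalar_mx => vB.
  have s0 : s = 0.
    have := congr1 (dot ^~ e1) vB; rewrite /= dot0l !dotDl !dotZl e11 dotC.
    by rewrite [dot e2 e1]dotC e12 mulr1 mulr0 addr0 dotC dot_mulmx -mulmxA Fe1
       mulmx0 mxE add0r.
  have t0 : t = 0.
    have := congr1 (dot ^~ e2) vB; rewrite /= dot0l !dotDl !dotZl e22 e12.
    by rewrite mulr1 mulr0 add0r dot_mulmx -mulmxA Fe2 mulmx0 mxE add0r.
  move: vB; rewrite s0 t0 !scale0r !addr0 => /Finj ->.
  by rewrite !raddf0 !row_mx0.
have Bfull : row_full B by rewrite /row_full (eqP Bfree) dE !addnS addn0.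
by rewrite -[P]mul1mx -(mulVpmx Bfull) -mulmxA BP.
Qed.

Lemma trace_mul_quad n (Q S : 'M[R]_n) :
  \tr (Q^T *m Q *m S) = \sum_i dot (row i Q *m S) (row i Q).
Proof.
rewrite -mulmxA mxtrace_mulC; apply: eq_bigr => i _.
rewrite -row_mul mxE; apply: eq_bigr => j _.
by rewrite [Q^T j i]mxE [row i Q 0 j]mxE [row i (Q *m S) 0 j]mxE.
Qed.

Lemma invmx_orthonormalize n (G Q : 'M[R]_n) : Q *m G *m Q^T = 1%:M ->
  invmx G = Q^T *m Q.
Proof.
move=> QG; have Qu : Q \in unitmx.
  by have [] := mulmx1_unit QG; rewrite unitmx_mul => /andP[].
have GE : (Q^T *m Q) *m G = 1%:M.
  by rewrite -mulmxA; exact: mulmx1C.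
have [_ Gu] := mulmx1_unit GE.
by rewrite -[LHS]mul1mx -GE mulmxK.
Qed.

(** Writing G^-1 = Q^T Q turns the trace into a sum of values of the quadratic
    form S on the rows of Q. This is how a Hessian that is nonnegative as a
    quadratic form yields a nonnegative Laplacian. *)
Lemma trace_invmx_ge0 n (G S : 'M[R]_n) : G^T = G ->
  (forall u : 'rV[R]_n, u != 0 -> 0 < dot (u *m G) u) ->
  (forall u : 'rV[R]_n, 0 <= dot (u *m S) u) -> 0 <= \tr (invmx G *m S).
Proof.
move=> Gs Gp Sp; have [Q QG] := posdef_orthonormalize Gs Gp.
by rewrite (invmx_orthonormalize QG) trace_mul_quad; apply: sumr_ge0.
Qed.

End Gram.
(** * Directional derivatives and minima *)

Section DirectionalDerivatives.
Context {R : realType}.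

(** The difference quotients on both sides are the same function. *)
Lemma is_derive_line (V W : normedModType R) (f : V -> W) u v t df :
  is_derive (u + t *: v) v f df -> is_derive t 1 (fun s : R => f (u + s *: v)) df.
Proof.
have E : (fun h : R => h^-1 *: (((fun s : R => f (u + s *: v)) \o shift t) (h *: 1)
    - f (u + t *: v)))
  = (fun h : R => h^-1 *: ((f \o shift (u + t *: v)) (h *: v) - f (u + t *: v))).
  apply/funext => h /=; congr (_ *: (f _ - _)).
  by rewrite [_ *: 1]mulr1 scalerDl addrCA.
by case=> fd <-; split; rewrite /derivable /derive E.
Qed.

Lemma is_derive_linear (V W W' : normedModType R) (L : {linear W -> W'})
    (f : V -> W) u v df :
  continuous L -> is_derive u v f df -> is_derive u v (L \o f) (L df).
Proof.
move=> Lc [fd <-].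
have key : (fun h : R => h^-1 *: (((L \o f) \o shift u) (h *: v) - (L \o f) u))
    @ 0^' --> L ('D_v f u).
  rewrite (_ : (fun h : R => _) =
    L \o (fun h : R => h^-1 *: ((f \o shift u) (h *: v) - f u))); last first.
    by apply/funext => h /=; rewrite linearZ; congr (_ *: _); rewrite linearB.
  by apply: continuous_cvg => //; exact: Lc.
by split; [apply/cvg_ex; exists (L ('D_v f u)) | exact: cvg_lim].
Qed.

Lemma is_derive_mxP (V : normedModType R) m n (M : V -> 'M[R]_(m, n)) t v dM :
  is_derive t v M dM <->
  forall i j, is_derive t v (fun x => M x i j) (dM i j).
Proof.
split=> [[Md <-] i j|Md].
  split; first by move/derivable_mxP: Md.
  by rewrite (derive_mx Md) mxE.
have Mdv : derivable M t v by apply/derivable_mxP => i j; exact: ex_derive.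
split=> //; apply/matrixP => i j; rewrite derive_mx // mxE.
exact: derive_val.
Qed.

Lemma is_derive_dot (V : normedModType R) m (f g : V -> 'rV[R]_m) t v df dg :
  is_derive t v f df -> is_derive t v g dg ->
  is_derive t v (fun x => dot (f x) (g x)) (dot df (g t) + dot (f t) dg).
Proof.
move=> /is_derive_mxP fd /is_derive_mxP gd.
rewrite (_ : (fun x => dot _ _) =
  \sum_(i < m) ((fun x => f x 0 i) * (fun x => g x 0 i))); last first.
  by apply/funext => x; rewrite fct_sumE.
apply: is_derive_eq; rewrite /dot -big_split; apply: eq_bigr => i _ /=.
by rewrite addrC [_ *: dg 0 i]/GRing.scale /= [_ *: _]mulrC.
Qed.

Lemma is_derive_row_mx (V : normedModType R) m n (f : V -> 'rV[R]_m)
    (g : V -> 'rV[R]_n) t v df dg :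
  is_derive t v f df -> is_derive t v g dg ->
  is_derive t v (fun x => row_mx (f x) (g x)) (row_mx df dg).
Proof.
move=> /is_derive_mxP fd /is_derive_mxP gd; apply/is_derive_mxP => i j.
rewrite mxE; case: splitP => k jk.
  rewrite (_ : (fun x => _) = (fun x => f x i k)) //.
  apply/funext => x; rewrite mxE; case: splitP => l; rewrite jk.
    by move/val_inj => ->.
  by move=> E; move: (ltn_ord k); rewrite E -ltn_subRL subnn.
rewrite (_ : (fun x => _) = (fun x => g x i k)) //.
apply/funext => x; rewrite mxE; case: splitP => l; rewrite jk.
  by move=> E; move: (ltn_ord l); rewrite -E -ltn_subRL subnn.
by move/addnI/val_inj => ->.
Qed.

(** If d were negative, g would be negative on some interval ]0, t[, so f would
    decrease there by the mean value theorem. *)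
Lemma second_derivative_at_min (f g : R -> R) (d e : R) : 0 < e ->
  (forall t : R, `|t| < e -> is_derive t (1 : R) f (g t)) ->
  is_derive (0 : R) (1 : R) g d -> (forall t : R, `|t| < e -> f 0 <= f t) ->
  g 0 = 0 /\ 0 <= d.
Proof.
move=> e0 fg gd fmin.
have inE t : t \in `](- e), e[%R -> `|t| < e by rewrite in_itv /= ltr_norml.
have fd t : t \in `](- e), e[%R -> derivable f t 1 by move=> /inE /fg [].
have g0 : g 0 = 0.
  have f0 : is_derive (0 : R) (1 : R) f (g 0) by apply: fg; rewrite normr0.
  have f0' : is_derive (0 : R) (1 : R) f 0.
    apply: (@derive1_at_min _ f (- e) e 0 _ fd) => [||t /inE /fmin //].
      by rewrite ge0_cp // ltW.
    by rewrite in_itv /= oppr_lt0 e0.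
  by rewrite -(@derive_val _ _ _ _ _ _ _ f0) (@derive_val _ _ _ _ _ _ _ f0').
split=> //; rewrite leNgt; apply/negP => d0.
have : (fun h : R => h^-1 *: ((g \o shift 0) (h *: 1) - g 0)) @ 0^' --> d.
  by case: gd => gd <-.
move=> /cvgr_lt /(_ _ d0) /nbhs_ballP [r /= r0 rP].
have gneg t : 0 < t -> t < r -> g t < 0.
  move=> t0 tr; have := rP t; rewrite /ball /= sub0r normrN gtr0_norm // tr.
  move=> /(_ isT (lt0r_neq0 t0)).
  by rewrite g0 subr0 addr0 [_ *: 1]mulr1 /GRing.scale /= pmulr_rlt0 // invr_gt0.
pose t0 := Num.min r e / 2.
have re0 : 0 < Num.min r e by rewrite lt_min r0 e0.
have t00 : 0 < t0 by rewrite divr_gt0.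
have t0m : t0 < Num.min r e by rewrite ltr_pdivrMr // ltr_pMr // ltr1n.
have t0r : t0 < r by apply: lt_le_trans t0m _; rewrite ge_min lexx.
have t0e : t0 < e by apply: lt_le_trans t0m _; rewrite ge_min lexx orbT.
have in0 t : 0 <= t -> t <= t0 -> `|t| < e.
  by move=> tp tt; rewrite ger0_norm // (le_lt_trans tt).
have [||c /[!in_itv] /= /andP[c0 ct] fE] := @MVT _ f g 0 t0 t00.
- by move=> x /[!in_itv] /= /andP[x0 xt]; apply/fg/in0; exact: ltW.
- apply: derivable_within_continuous => x /[!in_itv] /= /andP[x0 xt].
  by have [] := fg _ (in0 _ x0 xt).
have := fmin t0 (in0 _ (ltW t00) (lexx _)).
rewrite -subr_ge0 fE subr0 pmulr_lge0 // leNgt gneg //.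
exact: lt_trans ct t0r.
Qed.

End DirectionalDerivatives.
Section Continuity.
Context {R : realType}.

Lemma compact_argmin (T : topologicalType) (A : set T) (f : T -> R) :
  A !=set0 -> compact A -> (forall x, A x -> {for x, continuous f}) ->
  exists2 c, A c & forall t, A t -> f c <= f t.
Proof.
move=> A0 cA fc.
have [|c /[!inE] Ac cmin] := compact_EVT_min A0 cA (f := f).
  by apply: continuous_in_subspaceT => x /[!inE]; exact: fc.
by exists c => // t At; apply: cmin; rewrite inE.
Qed.

Lemma closed_ball_compact n (z : 'rV[R]_n) (e : R) :
  compact [set v : 'rV[R]_n | `|z - v| <= e].
Proof.
apply: bounded_closed_compact; last exact: closed_closed_ball_.
exists (`|z| + e); split; first by rewrite num_real.
move=> r rM v /= zv; apply: le_trans (ltW rM).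
rewrite -[v](subKr z) (le_trans (ler_normB _ _)) // lerD2l.
exact: zv.
Qed.

Lemma cvg_coord (T : Type) (F : set_system T) {FF : Filter F} m n
    (f : T -> 'M[R]_(m, n)) (l : 'M[R]_(m, n)) i j :
  f @ F --> l -> f x i j @[x --> F] --> l i j.
Proof.
move=> fl; exact: (@continuous_cvg _ _ _ _ _ f (fun A : 'M[R]_(m, n) => A i j) l
  (@coord_continuous R m n i j l) fl).
Qed.

Lemma cvg_mx (T : Type) (F : set_system T) {FF : Filter F} m n
    (f : T -> 'M[R]_(m, n)) (l : 'M[R]_(m, n)) :
  (forall i j, f x i j @[x --> F] --> l i j) -> f @ F --> l.
Proof.
move=> fl; apply/cvgrPdist_le => /= e e0; near=> x.
rewrite /Num.Def.normr /= mx_normrE (bigmax_le _ (ltW e0)) // => i _ /=.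
rewrite !mxE; move: i; near: x; apply: filter_forall => /= i.
exact: ((cvgrPdist_le _ _).1 (fl i.1 i.2)).
Unshelve. all: by end_near. Qed.

Lemma cvg_dot (T : Type) (F : set_system T) {FF : Filter F} m
    (f g : T -> 'rV[R]_m) (l l' : 'rV[R]_m) :
  f @ F --> l -> g @ F --> l' -> dot (f x) (g x) @[x --> F] --> dot l l'.
Proof.
move=> fl gl; apply: (@cvg_big R _ +%R) => [|i _]; first exact: add_continuous.
by apply: (@cvgM R T F FF (fun x => f x 0 i) (fun x => g x 0 i));
  exact: cvg_coord.
Qed.

Lemma cvg_mulmx (T : Type) (F : set_system T) {FF : Filter F} m n p
    (f : T -> 'M[R]_(m, n)) (g : T -> 'M[R]_(n, p)) (l : 'M[R]_(m, n)) (l' : 'M[R]_(n, p)) :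
  f @ F --> l -> g @ F --> l' -> (fun x => f x *m g x) @ F --> l *m l'.
Proof.
move=> fl gl; apply: cvg_mx => i j; rewrite mxE.
under eq_fun do rewrite mxE.
apply: (@cvg_big R _ +%R) => [|k _]; first exact: add_continuous.
by apply: (@cvgM R T F FF (fun x => f x i k) (fun x => g x k j));
  exact: cvg_coord.
Qed.

Lemma cvg_trmx (T : Type) (F : set_system T) {FF : Filter F} m n
    (f : T -> 'M[R]_(m, n)) (l : 'M[R]_(m, n)) :
  f @ F --> l -> (fun x => (f x)^T) @ F --> l^T.
Proof.
move=> fl; apply: cvg_mx => i j; rewrite mxE.
by under eq_fun do rewrite mxE; exact: cvg_coord.
Qed.

Lemma cvg_mxtrace (T : Type) (F : set_system T) {FF : Filter F} n
    (f : T -> 'M[R]_n) (l : 'M[R]_n) : f @ F --> l -> \tr (f x) @[x --> F] --> \tr l.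
Proof.
move=> fl; apply: (@cvg_big R _ +%R) => [|k _]; first exact: add_continuous.
exact: cvg_coord.
Qed.

Lemma cvg_det (T : Type) (F : set_system T) {FF : Filter F} n
    (f : T -> 'M[R]_n) (l : 'M[R]_n) : f @ F --> l -> \det (f x) @[x --> F] --> \det l.
Proof.
move=> fl; apply: (@cvg_big R _ +%R) => [|s _]; first exact: add_continuous.
apply: cvgMl_tmp; apply: (@cvg_big R _ *%R) => [|k _]; first exact: mul_continuous.
exact: cvg_coord.
Qed.

(** Cramer's rule reduces the claim to the continuity of determinants. *)
Lemma cvg_invmx (T : Type) (F : set_system T) {FF : Filter F} n
    (f : T -> 'M[R]_n) (l : 'M[R]_n) : l \in unitmx -> (\forall x \near F, f x \in unitmx) ->
  f @ F --> l -> invmx (f x) @[x --> F] --> invmx l.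
Proof.
move=> lu fu fl.
suff : (\det (f x))^-1 *: \adj (f x) @[x --> F] --> (\det l)^-1 *: \adj l.
  rewrite {2}/invmx lu; apply: cvg_trans; apply: near_eq_cvg.
  by apply: filterS fu => x fxu; rewrite /invmx fxu.
apply: cvgZ.
  by apply: cvgV; [rewrite -unitfE -unitmxE | exact: cvg_det].
apply: cvg_mx => i j; rewrite mxE; under eq_fun do rewrite mxE.
apply: cvgMl_tmp; apply: cvg_det; apply: cvg_mx => k l'; rewrite !mxE.
under eq_fun do rewrite !mxE.
exact: cvg_coord.
Qed.

Lemma cvg_sum_ord (T : Type) (F : set_system T) {FF : Filter F} m p n
    (f : 'I_n -> T -> 'M[R]_(m, p)) (l : 'I_n -> 'M[R]_(m, p)) :
  (forall i, f i @ F --> l i) ->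
  (fun x => \sum_i f i x) @ F --> \sum_i l i.
Proof.
move=> fl; apply: cvg_mx => j k; rewrite summxE.
under eq_fun do rewrite summxE.
apply: (@cvg_big R _ +%R) => [|i _]; first exact: add_continuous.
by apply: cvg_coord.
Qed.

Lemma cvg_line n (z xi : 'rV[R]_n) : (fun t : R => z + t *: xi) @ 0 --> z.
Proof.
rewrite -[X in _ --> X]addr0 -(scale0r xi); apply: cvgD; first exact: cvg_cst.
by apply: cvgZr_tmp; exact: cvg_id.
Qed.

(** The one-variable test on every line through z. *)
Lemma second_derivative_test n (w : 'rV[R]_n -> R) (g : 'rV[R]_n -> 'rV[R]_n)
    (h : 'M[R]_n) (z : 'rV[R]_n) :
  (\forall u \near z, forall xi, is_derive u xi w (dot xi (g u))) ->
  (forall xi, is_derive z xi (fun v => dot xi (g v)) (dot (xi *m h) xi)) ->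
  (\forall u \near z, w z <= w u) ->
  g z = 0 /\ forall xi, 0 <= dot (xi *m h) xi.
Proof.
move=> wg gh zmin.
have test xi : dot xi (g z) = 0 /\ 0 <= dot (xi *m h) xi.
  have [e /= e0 eP] : \forall t \near (0 : R),
      (forall xi', is_derive (z + t *: xi) xi' w (dot xi' (g (z + t *: xi)))) /\
      w z <= w (z + t *: xi).
    apply: filterI; first exact: (@cvg_line _ z xi _ wg).
    exact: (@cvg_line _ z xi _ zmin).
  have eP' t : `|t| < e -> (forall xi', is_derive (z + t *: xi) xi' w (dot xi' (g (z + t *: xi)))) /\
      w z <= w (z + t *: xi).
    by move=> te; apply: (eP t); rewrite /ball_ /= sub0r normrN.
  have [] := @second_derivative_at_min R (fun t => w (z + t *: xi))
    (fun t => dot xi (g (z + t *: xi))) (dot (xi *m h) xi) e e0.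
  - by move=> t /eP' [wd _]; exact: is_derive_line (wd xi).
  - apply: (@is_derive_line R _ _ (fun v => dot xi (g v)) z xi 0).
    by rewrite scale0r addr0; exact: gh.
  - by move=> t /eP' []; rewrite scale0r addr0.
  by rewrite scale0r addr0.
split; last by move=> xi; case: (test xi).
by apply/eqP; rewrite -dot_eq0 (test _).1.
Qed.
End Continuity.
(** * The strong minimum principle *)

Section StrongMinimum.
Context {R : realType}.

Lemma closed_preimage_within (T : topologicalType) (A : set T) (f : T -> R)
    (B : set R) : closed A -> closed B ->
  (forall x, A x -> {for x, continuous f}) -> closed (A `&` f @^-1` B).
Proof.
move=> Acl Bcl fc x xcl.
have Ax : A x by apply: Acl => V /xcl [y [[Ay _] Vy]]; exists y.
split=> //; apply: Bcl => V /(fc _ Ax) /xcl [y [[_ By] Vy]].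
by exists (f y).
Qed.

Lemma norm_le_enorm n (v : 'rV[R]_n) : `|v| <= enorm v.
Proof.
rewrite /Num.Def.normr /= mx_normrE; apply: bigmax_le => [|[i j] _ /=].
  exact: sqrtr_ge0.
by rewrite ord1 -sqrtr_sqr ler_wsqrtr // dot_coord_le.
Qed.

Lemma enorm_lt n (v : 'rV[R]_n) r : 0 < r -> (enorm v < r) = (dot v v < r ^+ 2).
Proof.
by move=> r0; rewrite -enormK ltr_pXn2r ?nnegrE ?sqrtr_ge0 // ltW.
Qed.

Lemma closed_subset_compact (T : topologicalType) (A B : set T) :
  compact A -> closed B -> B `<=` A -> compact B.
Proof. by move=> Ac Bc BA; exact: subclosed_compact Bc Ac BA. Qed.

Section Barrier.
Context {n : nat} (nu z0 : 'rV[R]_n) (beta : R).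

(** { bump >= 0 } is the closed ball with centre z0 + nu / 2 whose boundary passes
    through z0; bump is increasing towards its centre. *)
Definition bump (u : 'rV[R]_n) : R := dot nu (u - z0) - dot (u - z0) (u - z0).
Definition bump_grad (u : 'rV[R]_n) : 'rV[R]_n := nu - 2 *: (u - z0).
(** A convex increasing function of bump near bump = 0: a large beta makes the
    second-order part of an elliptic operator dominate. *)
Definition barrier (u : 'rV[R]_n) : R := bump u + beta * bump u ^+ 2.
Definition barrier_grad (u : 'rV[R]_n) : 'rV[R]_n :=
  (1 + 2 * beta * bump u) *: bump_grad u.
Definition barrier_hess (u : 'rV[R]_n) : 'M[R]_n :=
  (1 + 2 * beta * bump u) *: (- 2)%:M
  + (2 * beta) *: ((bump_grad u)^T *m bump_grad u).

Lemma bump_z0 : bump z0 = 0.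
Proof. by rewrite /bump subrr !dot0r subrr. Qed.

Lemma bump_grad_z0 : bump_grad z0 = nu.
Proof. by rewrite /bump_grad subrr scaler0 subr0. Qed.

Lemma is_derive_id_sub u xi : is_derive u xi (fun v => v - z0) xi.
Proof.
rewrite -[X in is_derive _ _ _ X]subr0.
exact: (@is_deriveB R _ _ id (cst z0) u xi xi 0).
Qed.

Lemma is_derive_bump u xi : is_derive u xi bump (dot xi (bump_grad u)).
Proof.
have := @is_deriveB R _ _ _ _ u xi _ _
  (is_derive_dot (is_derive_cst nu u xi) (is_derive_id_sub u xi))
  (is_derive_dot (is_derive_id_sub u xi) (is_derive_id_sub u xi)).
move=> /is_derive_eq; apply.
rewrite dot0l add0r /bump_grad !(dotBr, dotBl, dotZr, dotZl) (dotC u) (dotC z0).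
by rewrite (dotC nu); ring.
Qed.

Lemma is_derive_barrier u xi :
  is_derive u xi barrier (dot xi (barrier_grad u)).
Proof.
have bd := is_derive_bump u xi.
have := is_deriveD bd (is_deriveZ beta (is_deriveM bd bd)).
rewrite (_ : bump + _ = barrier); last first.
  by apply/funext => v; rewrite /barrier expr2.
move=> /is_derive_eq; apply.
rewrite /barrier_grad dotZr /GRing.scale /=.
by ring.
Qed.

Lemma is_derive_bump_grad u xi : is_derive u xi bump_grad ((- 2) *: xi).
Proof.
have sd := is_derive_id_sub u xi.
apply: is_derive_eq (is_deriveB (is_derive_cst nu u xi) (is_deriveZ 2 sd)) _.
by rewrite sub0r scaleNr.
Qed.

Lemma is_derive_barrier_grad u xi eta :
  is_derive u xi (fun v => dot eta (barrier_grad v))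
    (dot (xi *m barrier_hess u) eta).
Proof.
have bd := is_derive_bump u xi.
have gd := is_derive_dot (is_derive_cst eta u xi) (is_derive_bump_grad u xi).
have fd := is_deriveD (is_derive_cst (1 : R) u xi) (is_deriveZ (2 * beta) bd).
have := is_deriveM fd gd.
rewrite (_ : _ * _ = fun v => dot eta (barrier_grad v)); last first.
  by apply/funext => v; rewrite /barrier_grad dotZr.
move=> /is_derive_eq; apply.
rewrite /barrier_hess; move: (bump_grad u) => s.
rewrite [(cst 1 + _) u](_ : _ = 1 + 2 * beta * bump u) //.
rewrite mulmxDr -!scalemxAr mul_mx_scalar mulmxA mx11_mul mul_scalar_mx.
rewrite dot0l !(dotDl, dotZl, dotZr) (dotC eta s) (dotC eta xi).
by rewrite /GRing.scale /=; ring.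
Qed.

End Barrier.
End StrongMinimum.
Lemma continuous_dist (R : realType) (V : normedModType R) (z : V) :
  continuous (fun u : V => `|z - u|).
Proof.
move=> u; apply: (@continuous_comp _ _ _ (fun v => z - v) Num.norm u).
  exact: (continuousB (@cst_continuous _ _ _ _)).
exact: norm_continuous.
Qed.

Section Elliptic.
Context {R : realType} {n : nat}.

Lemma trace_mul_outer (P : 'M[R]_n) (s : 'rV[R]_n) :
  \tr (P *m (s^T *m s)) = dot (s *m P) s.
Proof.
by rewrite mulmxA mxtrace_mulC mulmxA mx11_mul mxtrace_scalar.
Qed.

Variables (U : set 'rV[R]_n) (P : 'rV[R]_n -> 'M[R]_n).
Variables (c g : 'rV[R]_n -> 'rV[R]_n) (w : 'rV[R]_n -> R).
Variable h : 'rV[R]_n -> 'M[R]_n.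
Hypothesis Uo : open U.
Hypothesis Pc : forall u, U u -> {for u, continuous P}.
Hypothesis cc : forall u, U u -> {for u, continuous c}.
Hypothesis Ppsd : forall u, U u -> forall S : 'M[R]_n,
  (forall xi : 'rV[R]_n, 0 <= dot (xi *m S) xi) -> 0 <= \tr (P u *m S).
Hypothesis Ppos : forall u, U u -> forall xi : 'rV[R]_n,
  xi != 0 -> 0 < dot (xi *m P u) xi.
Hypothesis wc : forall u, U u -> {for u, continuous w}.
Hypothesis wg : forall u xi, U u -> is_derive u xi w (dot xi (g u)).
Hypothesis gh : forall u xi eta, U u ->
  is_derive u xi (fun v => dot eta (g v)) (dot (xi *m h u) eta).
Hypothesis w0 : forall u, U u -> 0 <= w u.
Hypothesis Lw : forall u, U u -> \tr (P u *m h u) + dot (c u) (g u) <= 0.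

Lemma cvg_sub_cst (z u : 'rV[R]_n) : (fun v => v - z) @ u --> u - z.
Proof. exact: (cvgB cvg_id (cvg_cst z)). Qed.

Lemma continuous_bump nu z0 : continuous (@bump R n nu z0).
Proof.
move=> u; have sc : (fun v => v - z0) @ u --> u - z0.
  exact: cvg_sub_cst.
exact: (cvgB (cvg_dot (cvg_cst nu) sc) (cvg_dot sc sc)).
Qed.

Lemma cvg_bump_grad (nu z0 u : 'rV[R]_n) :
  bump_grad nu z0 @ u --> bump_grad nu z0 u.
Proof.
apply: (@cvg_mx R _ (nbhs u)) => i j; rewrite !mxE.
under eq_fun do rewrite !mxE.
apply: cvgB; first exact: cvg_cst.
apply: cvgMl_tmp; apply: cvgB; last exact: cvg_cst.
exact: coord_continuous.
Qed.

Lemma continuous_barrier nu z0 beta : continuous (@barrier R n nu z0 beta).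
Proof.
move=> u; have bc := @continuous_bump nu z0 u.
rewrite /continuous_at (_ : barrier nu z0 beta =
  fun v => bump nu z0 v + beta * (bump nu z0 v * bump nu z0 v)); last first.
  by apply/funext => v; rewrite -expr2.
exact: (cvgD bc (@cvgMl_tmp R _ _ _ _ beta _ (cvgM bc bc))).
Qed.

Let L_barrier nu z0 beta u :=
  \tr (P u *m barrier_hess nu z0 beta u) + dot (c u) (barrier_grad nu z0 beta u).

Let L_barrierE nu z0 beta u : L_barrier nu z0 beta u =
  (1 + 2 * beta * bump nu z0 u) * (dot (c u) (bump_grad nu z0 u) - 2 * \tr (P u))
  + 2 * beta * dot (bump_grad nu z0 u *m P u) (bump_grad nu z0 u).
Proof.
rewrite /L_barrier /barrier_hess /barrier_grad; move: (bump_grad _ _ u) => s.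
rewrite mulmxDr -!scalemxAr mul_mx_scalar linearD /= !linearZ /=.
by rewrite trace_mul_outer dotZr /GRing.scale /=; ring.
Qed.

(** Hopf's argument. If w vanishes at z0 and is positive on a ball touching z0,
    subtract a small multiple of the barrier v from w. On the boundary of a small
    cube around z0 the difference stays positive: where bump < 0 because v < 0,
    elsewhere because w is bounded below by compactness. It vanishes at z0, so it
    has an interior minimum; there the operator is nonnegative on w - eps v,
    although it is nonpositive on w and positive on v. *)
Lemma hopf_contact (nu z0 : 'rV[R]_n) : U z0 -> w z0 = 0 -> nu != 0 ->
  (\forall u \near z0, 0 <= bump nu z0 u -> u != z0 -> 0 < w u) -> False.
Proof.
move=> Uz0 wz0 nu0 wpos.
have FF : Filter (nbhs z0) := nbhs_filter z0.
have := Ppos Uz0 nu0; set a := dot _ _ => a0.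
pose b := dot (c z0) nu - 2 * \tr (P z0).
(* This makes the operator at least 1 on the barrier at z0, where it is
   b + 2 beta a. *)
pose beta := (`|b| + 1) / (2 * a).
have beta0 : 0 < beta by rewrite divr_gt0 ?mulr_gt0 // ltr_wpDl.
pose bmp := bump nu z0; pose v := barrier nu z0 beta.
have bc : continuous bmp by exact: continuous_bump.
have vc : continuous v by exact: continuous_barrier.
have sc : bump_grad nu z0 @ z0 --> bump_grad nu z0 z0.
  exact: cvg_bump_grad.
have Lz0 : 0 < L_barrier nu z0 beta z0.
  rewrite L_barrierE bump_z0 bump_grad_z0 mulr0 addr0 mul1r -/a -/b.
  have -> : 2 * beta * a = `|b| + 1 by rewrite /beta; field; rewrite gt_eqF.
  by have := ler_norm (- b); rewrite normrN; lra.
have Lc : L_barrier nu z0 beta @ z0 --> L_barrier nu z0 beta z0.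
  rewrite (funext (@L_barrierE nu z0 beta)) /=.
  have Pz : P @ z0 --> P z0 by exact: Pc.
  have cz : c @ z0 --> c z0 by exact: cc.
  have sPc : (fun u => bump_grad nu z0 u *m P u) @ z0 --> bump_grad nu z0 z0 *m P z0.
    exact: (cvg_mulmx sc Pz).
  have bz : bmp u @[u --> z0] --> bmp z0 by exact: bc.
  pose proof (cvgD (cvg_cst (1 : R)) (cvgMl_tmp (a := 2 * beta) bz)) as c1.
  pose proof (cvgB (cvg_dot cz sc) (cvgMl_tmp (a := 2) (cvg_mxtrace Pz))) as c2.
  pose proof (cvgMl_tmp (a := 2 * beta) (cvg_dot sPc sc)) as c3.
  exact: (cvgD (cvgM c1 c2) c3).
have bz0 : bmp z0 = 0 by exact: bump_z0.
have /nbhs_ballP[e /= e0 eP] : \forall u \near z0, [/\ U u, 0 < L_barrier nu z0 beta u,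
    0 < 1 + beta * bmp u & 0 <= bmp u -> u != z0 -> 0 < w u].
  near=> u; split; near: u.
  - exact: Uo.
  - exact: (cvgr_gt _ Lc).
  - apply: (cvgr_gt (1 + beta * bmp z0)); last by rewrite bz0 mulr0 addr0.
    by apply: cvgD; [exact: cvg_cst | apply: cvgMl_tmp; exact: bc].
  - exact: wpos.
pose r := e / 2; have r0 : 0 < r by rewrite divr_gt0.
have rP u : `|z0 - u| <= r -> [/\ U u, 0 < L_barrier nu z0 beta u,
    0 < 1 + beta * bmp u & 0 <= bmp u -> u != z0 -> 0 < w u].
  move=> zu; apply: eP; rewrite -ball_normE /ball_ /= (le_lt_trans zu) //.
  by rewrite ltr_pdivrMr // ltr_pMr // ltr1n.
pose K := [set u : 'rV[R]_n | `|z0 - u| <= r].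
have Kc : compact K by exact: closed_ball_compact.
have KU u : K u -> U u by move=> /rP [].
pose S := [set u | [/\ `|z0 - u| = r & 0 <= bmp u]].
have Sc : compact S.
  apply: (closed_subset_compact Kc); last by move=> u [/= ur _]; rewrite /K /= ur.
  have nc : continuous (fun u : 'rV[R]_n => `|z0 - u|).
    exact: continuous_dist.
  rewrite (_ : S = (setT `&` (fun u : 'rV[R]_n => `|z0 - u|) @^-1` [set r])
     `&` (setT `&` bmp @^-1` [set x | 0 <= x])).
    apply: closedI; (apply: closed_preimage_within; first exact: closedT).
    - exact: closed_eq.
    - by move=> u _; exact: nc.
    - exact: closed_ge.
    - by move=> u _; exact: bc.
  apply/seteqP; split=> u; first by case=> h1 h2; split; split.
  by case=> -[_ h1] [_ h2]; split.
have SK u : S u -> K u by move=> [/= ur _]; rewrite /K /= ur.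
have Spos u : S u -> 0 < w u.
  move=> Su; have [/= ur ub] := Su; have [_ _ _] := rP _ (SK _ Su); apply=> //.
  by apply: contra_eqN ur => /eqP ->; rewrite subrr normr0 lt_eqF.
have [eps [eps0 epsP]] : exists eps, 0 < eps /\
    forall u, `|z0 - u| = r -> 0 < w u - eps * v u.
  have vneg u : `|z0 - u| = r -> bmp u < 0 -> v u < 0.
    move=> ur bu; have [|_ _ b1 _] := rP u; first by rewrite ur.
    rewrite /v /barrier -/(bmp u) (_ : _ + _ = bmp u * (1 + beta * bmp u)).
      by rewrite pmulr_llt0.
    by ring.
  have [[s Ss]|S0] := pselect (S !=set0); last first.
    exists 1; split=> // u ur; have [bu|bu] := ltP (bmp u) 0.
      rewrite mul1r subr_gt0; apply: lt_le_trans (vneg _ ur bu) _.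
      by apply/w0/KU; rewrite /K /= ur.
    by exfalso; apply: S0; exists u; split.
  have [|c1 Sc1 c1P] := @compact_argmin R _ S w (ex_intro _ s Ss) Sc.
    by move=> u /SK/KU; exact: wc.
  have [|c2 Sc2 c2P] := @compact_argmin R _ S (fun u => - v u) (ex_intro _ s Ss) Sc.
    by move=> u _; apply: continuousN; exact: vc.
  have k0 : 0 < `|v c2| + 1 by rewrite ltr_wpDl.
  have d0 := Spos _ Sc1.
  have e10 : 0 < w c1 / (`|v c2| + 1) by rewrite divr_gt0.
  exists (w c1 / (`|v c2| + 1)); split=> // u ur; rewrite subr_gt0.
  have [bu|bu] := ltP (bmp u) 0.
    apply: (@lt_le_trans _ _ 0); last by apply/w0/KU; rewrite /K /= ur.
    by rewrite pmulr_rlt0 // vneg.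
  have Su : S u by split.
  apply: lt_le_trans (c1P _ Su); rewrite mulrAC ltr_pdivrMr // ltr_pM2l //.
  have := c2P _ Su; rewrite lerN2 => /le_lt_trans; apply.
  by rewrite (le_lt_trans (ler_norm _)) // ltrDl.
pose phi u := w u - eps * v u.
have phi_z0 : phi z0 = 0.
  by rewrite /phi wz0 /v /barrier bump_z0 expr0n !mulr0 addr0 mulr0 subr0.
have z0K : K z0 by rewrite /K /= subrr normr0 ltW.
have [|m Km mP] := @compact_argmin R _ K phi (ex_intro _ z0 z0K) Kc.
  move=> u /KU Uu; apply: continuousB; first exact: wc.
  by apply: continuousM; [exact: cst_continuous | exact: vc].
have phim : phi m <= 0 by rewrite -phi_z0; exact: mP.
have mr : `|z0 - m| < r.
  rewrite lt_neqAle Km andbT; apply/eqP => /epsP.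
  by rewrite ltNge; apply/negP; rewrite negbK.
have Um := KU _ Km.
have nearK : \forall u \near m, K u.
  have : \forall u \near m, `|z0 - u| < r.
    by move: (@continuous_dist R 'rV[R]_n z0 m) => /cvgr_lt /(_ _ mr).
  by apply: filterS => u; exact: ltW.
have [|||gm hm] := @second_derivative_test R n phi
  (fun u => g u - eps *: barrier_grad nu z0 beta u)
  (h m - eps *: barrier_hess nu z0 beta m) m.
- apply: filterS nearK => u /KU Uu xi.
  apply: is_derive_eq (is_deriveB (wg xi Uu)
    (is_deriveZ eps (is_derive_barrier nu z0 beta u xi))) _.
  by rewrite [RHS]dotBr [X in _ = _ - X]dotZr.
- move=> xi.
  have := is_deriveB (gh xi xi Um)
    (is_deriveZ eps (is_derive_barrier_grad nu z0 beta m xi xi)).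
  rewrite (_ : _ - _ = (fun v0 => dot xi (g v0 - eps *: barrier_grad nu z0 beta v0))).
    by move=> /is_derive_eq; apply; rewrite mulmxBr dotBl -scalemxAr dotZl.
  by apply/funext => u; rewrite [RHS]dotBr [X in _ = _ - X]dotZr.
- by apply: filterS nearK => u Ku; exact: mP.
have := Ppsd Um hm; rewrite mulmxBr -scalemxAr linearB linearZ /=.
move: gm => /eqP; rewrite subr_eq0 => /eqP gm.
have [_ Lm _ _] := rP _ Km; have := Lw Um; rewrite gm dotZr.
move=> H1 H2; have : eps * L_barrier nu z0 beta m <= 0.
  rewrite /L_barrier mulrDr; apply: le_trans H1; rewrite lerD2r.
  by rewrite -subr_ge0.
by rewrite leNgt mulr_gt0.
Unshelve. all: by end_near. Qed.

(** If w does not vanish identically near u0, choose q near u0 with w q > 0 and let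
    z0 be a zero of w nearest to q. The open ball around q through z0 contains no
    zero, and the bump at z0 lies in it, contradicting the previous lemma. *)
Lemma strong_minimum_principle u0 : U u0 -> w u0 = 0 ->
  \forall u \near u0, w u = 0.
Proof.
move=> Uu0 wu0.
have /nbhs_ballP[e /= e0 eP] : nbhs u0 U by exact: Uo.
pose r := e / 2; have r0 : 0 < r by rewrite divr_gt0.
pose K := [set u : 'rV[R]_n | `|u0 - u| <= r].
have KU u : K u -> U u.
  move=> zu; apply: eP; rewrite -ball_normE /ball_ /= (le_lt_trans zu) //.
  by rewrite ltr_pdivrMr // ltr_pMr // ltr1n.
pose s := r / 2; have s0 : 0 < s by rewrite divr_gt0.
suff sP q : enorm (q - u0) < s -> w q = 0.
  have sc : continuous (fun u : 'rV[R]_n => dot (u - u0) (u - u0)).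
    by move=> u; exact: (cvg_dot (@cvg_sub_cst u0 u) (@cvg_sub_cst u0 u)).
  have : dot (u0 - u0) (u0 - u0) < s ^+ 2.
    by rewrite subrr dot0r exprn_gt0.
  move: (sc u0) => /cvgr_lt h1 /h1; apply: filterS => u.
  by rewrite -enorm_lt //; exact: sP.
move=> qu0; apply: contrapT => /eqP wq.
pose Z := K `&` w @^-1` [set 0].
have Kc : compact K by exact: closed_ball_compact.
have Zc : compact Z.
  apply: (closed_subset_compact Kc); last by move=> u [].
  apply: closed_preimage_within; first exact: closed_closed_ball_.
    exact: closed_eq.
  by move=> u /KU; exact: wc.
have Zu0 : Z u0 by split; rewrite /K /= ?subrr ?normr0 ?(ltW r0).
have qc : continuous (fun u : 'rV[R]_n => dot (u - q) (u - q)).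
  by move=> u; exact: (cvg_dot (@cvg_sub_cst q u) (@cvg_sub_cst q u)).
have [|z0 [Kz0 wz0] z0P] := compact_argmin (ex_intro _ u0 Zu0) Zc
  (f := fun u : 'rV[R]_n => dot (u - q) (u - q)).
  by move=> u _; exact: qc.
have zr : `|u0 - z0| < r.
  rewrite -[u0 - z0](subrKA q) (le_lt_trans (ler_normD _ _)) //.
  have -> : r = s + s by rewrite /s; field.
  apply: ltrD; apply: (le_lt_trans (norm_le_enorm _)).
    by rewrite -opprB enorm_lt // dotNl dotNr opprK -enorm_lt.
  rewrite -opprB enorm_lt // dotNl dotNr opprK.
  apply: (le_lt_trans (z0P _ Zu0)).
  by rewrite -opprB dotNl dotNr opprK -enorm_lt.
have nu0 : q - z0 != 0.
  by apply: contra_neq wq => /subr0_eq ->.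
apply: (hopf_contact (KU _ Kz0) wz0 nu0).
have nearK : \forall u \near z0, K u.
  have : \forall u \near z0, `|u0 - u| < r.
    by move: (@continuous_dist R 'rV[R]_n u0 z0) => /cvgr_lt /(_ _ zr).
  by apply: filterS => u; exact: ltW.
apply: filterS nearK => u Ku bu uz; rewrite lt_neqAle w0 ?andbT; last exact: KU.
apply: contra_neq uz => wu; apply/eqP; rewrite -subr_eq0 -dot_eq0.
have := z0P u (conj Ku (esym wu)).
have -> : u - q = (u - z0) - (q - z0) by rewrite opprB addrC addrA subrK addrC.
have -> : z0 - q = - (q - z0) by rewrite opprB.
move: bu; rewrite /bump; move: (q - z0) (u - z0) => nu d.
rewrite !(dotBl, dotBr, dotNl, dotNr) (dotC d nu) eq_le dot_ge0 andbT.
by lra.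
Qed.

End Elliptic.
(** * The hypersurface in a chart *)

Section Frames.
Context {R : realType}.

(** R^a x R^b as one space of row vectors, on which matrices act. *)
Definition flat {a b : nat} (q : 'rV[R]_a * 'rV[R]_b) : 'rV[R]_(a + b) :=
  row_mx q.1 q.2.

Lemma dotE_flat a b (v w : 'rV[R]_a * 'rV[R]_b) : dotE v w = dot (flat v) (flat w).
Proof. by rewrite dot_row_mx. Qed.

Lemma fst_sum (V W : zmodType) I (s : seq I) (P : pred I) (f : I -> V * W) :
  (\sum_(i <- s | P i) f i).1 = \sum_(i <- s | P i) (f i).1.
Proof. exact: (big_morph fst (fun _ _ => erefl) erefl). Qed.

Lemma is_derive_fst (V W W' : normedModType R) (f : V -> W * W') u v df :
  is_derive u v f df -> is_derive u v (fun x => (f x).1) df.1.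
Proof.
move=> fd; apply: (is_derive_linear (L := fst)) fd => x; exact: cvg_fst.
Qed.

Lemma is_derive_snd (V W W' : normedModType R) (f : V -> W * W') u v df :
  is_derive u v f df -> is_derive u v (fun x => (f x).2) df.2.
Proof.
move=> fd; apply: (is_derive_linear (L := snd)) fd => x; exact: cvg_snd.
Qed.

Lemma is_derive_flat (V : normedModType R) a b (f : V -> 'rV[R]_a * 'rV[R]_b) u v df :
  is_derive u v f df -> is_derive u v (fun x => flat (f x)) (flat df).
Proof.
by move=> fd; apply: is_derive_row_mx; [exact: is_derive_fst | exact: is_derive_snd].
Qed.

Lemma is_derive_partial n (W : normedModType R) (f : 'rV[R]_n -> W) u xi :
  differentiable f u -> is_derive u xi f (\sum_i xi 0 i *: partial i f u).
Proof.
move=> fd; split; first exact: diff_derivable.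
rewrite deriveE // {1}[xi]row_sum_delta linear_sum; apply: eq_bigr => i _.
by rewrite linearZ /partial deriveE.
Qed.

Lemma diff_partial n (W : normedModType R) (f : 'rV[R]_n -> W) u (xi : 'rV[R]_n) :
  differentiable f u -> 'd f u xi = \sum_i xi 0 i *: partial i f u.
Proof.
by move=> fd; rewrite -deriveE //; have [_ ->] := is_derive_partial xi fd.
Qed.

Lemma Cinfty_differentiable n (W : normedModType R) U (f : 'rV[R]_n -> W) u :
  Cinfty U f -> U u -> differentiable f u.
Proof. by move=> /(_ 1%N) [+ _] => /[apply]. Qed.

Lemma Cinfty_partial n (W : normedModType R) U (f : 'rV[R]_n -> W) i :
  Cinfty U f -> Cinfty U (partial i f).
Proof. by move=> fs r; have [_] := fs r.+1; apply. Qed.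

Lemma Cinfty_continuous n (W : normedModType R) U (f : 'rV[R]_n -> W) u :
  Cinfty U f -> U u -> f @ u --> f u.
Proof. by move=> /(_ 0%N); apply. Qed.

Lemma cvg_flat (T : Type) (F : set_system T) {FF : Filter F} a b
    (f : T -> 'rV[R]_a * 'rV[R]_b) (l : 'rV[R]_a * 'rV[R]_b) :
  f @ F --> l -> flat (f x) @[x --> F] --> flat l.
Proof.
move=> fl; apply: cvg_mx => i j; rewrite mxE; under eq_fun do rewrite mxE.
have f1 : (f x).1 @[x --> F] --> l.1.
  exact: (@cvg_comp _ _ _ f fst F _ _ fl (@cvg_fst _ _ (nbhs l.1) (nbhs l.2) _)).
have f2 : (f x).2 @[x --> F] --> l.2.
  exact: (@cvg_comp _ _ _ f snd F _ _ fl (@cvg_snd _ _ (nbhs l.1) (nbhs l.2) _)).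
by case: splitP => k _; exact: cvg_coord.
Qed.

End Frames.

Section Potential.
Context {R : realType} {a b : nat}.

Lemma potentialE (q : 'rV[R]_a * 'rV[R]_b) : potential q = dot q.1 q.1 / 4.
Proof. by rewrite /potential enormK. Qed.

Lemma is_derive_potential (q v : 'rV[R]_a * 'rV[R]_b) :
  is_derive q v potential (dot v.1 q.1 / 2).
Proof.
have qd := is_derive_fst (is_derive_id q v).
rewrite (_ : potential = 4^-1 \*: (fun q : 'rV[R]_a * 'rV[R]_b => dot q.1 q.1)).
  apply: is_derive_eq (is_deriveZ _ (is_derive_dot qd qd)) _.
  by rewrite (dotC q.1) /GRing.scale /=; field.
by apply/funext => p; rewrite potentialE mulrC.
Qed.

Lemma cyl_grad_potential (q : 'rV[R]_a * 'rV[R]_b) :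
  cyl_grad potential q = (2^-1 *: q.1, 0).
Proof.
rewrite /cyl_grad /cyl_proj /=.
have -> : \row_j 'D_((0, delta_mx 0 j) : 'rV[R]_a * 'rV[R]_b) potential q = 0.
  apply/rowP => j; rewrite !mxE.
  have [_ ->] := is_derive_potential q ((0, delta_mx 0 j) : 'rV[R]_a * 'rV[R]_b).
  by rewrite dot0l mul0r.
rewrite dot0l mul0r scale0r subr0; congr pair.
apply/rowP => i; rewrite !mxE.
have [_ ->] := is_derive_potential q ((delta_mx 0 i, 0) : 'rV[R]_a * 'rV[R]_b).
by rewrite /= dotC dot_delta mulrC.
Qed.

End Potential.
Section Hypersurface.
Context {R : realType} {n a b : nat} (ab : (a + b = n.+2)%N).
Context {M : topologicalType} (A : smooth_atlas R n M) (rho : R) (rho0 : 0 < rho).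
Variables X N : M -> 'rV[R]_a * 'rV[R]_b.
Hypothesis hX : immersion_in_cylinder A rho X.
Hypothesis hN : unit_normal_field A X N.
Hypothesis hmin : f_minimal A X N.

Let y_sphere p : dot (X p).2 (X p).2 = rho ^+ 2.
Proof. by have [_ /(_ p) [_ <-] _] := hX; rewrite enormK. Qed.

Let N_unit p : dotE (N p) (N p) = 1.
Proof. by have [_ _ /(_ p)] := hN. Qed.

Let N_tangent p : dot (N p).2 (X p).2 = 0.
Proof. by have [_ /(_ p)] := hN. Qed.

Variables (c : chart R n M) (hc : charts A c).

Let F := X \o param c.

Lemma chart_smooth : Cinfty (dom c) F.
Proof. by have [/(_ c hc)] := hX. Qed.

(** The coordinate vectors and their derivatives are sealed behind opaque proofs:
    unfolded, they are limits of difference quotients, which unification would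
    try to compare. *)
Fact tang_sig : {t | forall i, t i = partial i F}.
Proof. by exists (fun i => partial i F). Qed.

Fact tang2_sig : {t | forall i j, t i j = partial i (partial j F)}.
Proof. by exists (fun i j => partial i (partial j F)). Qed.

Definition tang (i : 'I_n) : 'rV[R]_n -> 'rV[R]_a * 'rV[R]_b := sval tang_sig i.

Definition tang2 (i j : 'I_n) : 'rV[R]_n -> 'rV[R]_a * 'rV[R]_b :=
  sval tang2_sig i j.

Lemma tangE i : tang i = partial i F. Proof. exact: (svalP tang_sig). Qed.

Lemma tang2E i j : tang2 i j = partial i (partial j F).
Proof. exact: (svalP tang2_sig). Qed.

Lemma is_derive_chart u xi : dom c u ->
  is_derive u xi F (\sum_i xi 0 i *: tang i u).
Proof.
move=> cu; rewrite [X in is_derive _ _ _ X](eq_bigr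
  (fun i => xi 0 i *: partial i F u)) => [|i _]; last by rewrite tangE.
exact/is_derive_partial/(Cinfty_differentiable chart_smooth).
Qed.

Lemma is_derive_tang j u xi : dom c u ->
  is_derive u xi (tang j) (\sum_i xi 0 i *: tang2 i j u).
Proof.
move=> cu; rewrite tangE [X in is_derive _ _ _ X](eq_bigr
  (fun i => xi 0 i *: partial i (partial j F) u)) => [|i _]; last by rewrite tang2E.
exact/is_derive_partial/(Cinfty_differentiable (Cinfty_partial j chart_smooth)).
Qed.

Lemma diff_chart u xi : dom c u -> 'd F u xi = \sum_i xi 0 i *: tang i u.
Proof.
move=> cu; rewrite [RHS](eq_bigr
  (fun i => xi 0 i *: partial i F u)) => [|i _]; last by rewrite tangE.
exact/diff_partial/(Cinfty_differentiable chart_smooth).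
Qed.

Lemma cvg_tang i u : dom c u -> tang i @ u --> tang i u.
Proof.
move=> cu; rewrite tangE.
exact: (Cinfty_continuous (Cinfty_partial i chart_smooth)).
Qed.

Lemma cvg_tang2 i j u : dom c u -> tang2 i j @ u --> tang2 i j u.
Proof.
move=> cu; rewrite tang2E.
exact: (Cinfty_continuous (Cinfty_partial i (Cinfty_partial j chart_smooth))).
Qed.

Lemma sum_delta_tang i u : \sum_j (delta_mx 0 i : 'rV[R]_n) 0 j *: tang j u = tang i u.
Proof.
rewrite (bigD1 i) //= mxE !eqxx scale1r big1 ?addr0 // => j ji.
by rewrite mxE (negPf ji) andbF scale0r.
Qed.

Definition jac (u : 'rV[R]_n) : 'M[R]_(n, a + b) :=
  \matrix_(i, j) flat (tang i u) 0 j.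

Lemma row_jac i u : row i (jac u) = flat (tang i u).
Proof. by apply/rowP => j; rewrite !mxE. Qed.

Lemma mul_jac (xi : 'rV[R]_n) u :
  xi *m jac u = flat (\sum_i xi 0 i *: tang i u).
Proof.
rewrite mulmx_sum_row.
transitivity (\sum_i xi 0 i *: flat (tang i u)).
  by apply: eq_bigr => i _; rewrite row_jac.
elim/big_rec2: _ => [|i y1 y2 _ ->]; first by rewrite /flat row_mx0.
by rewrite /flat scale_row_mx add_row_mx.
Qed.

Lemma dot_mul_jacT (v : 'rV[R]_(a + b)) u i :
  (v *m (jac u)^T) 0 i = dot v (flat (tang i u)).
Proof. by rewrite -dot_delta dot_mulmxl trmxK -rowE row_jac. Qed.

Lemma first_formE u : first_form X c u = jac u *m (jac u)^T.
Proof.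
apply/matrixP => i j; rewrite [LHS]mxE dotE_flat.
have frameE k : frame X c k u = tang k u by rewrite tangE.
by rewrite !frameE gram_coef !row_jac.
Qed.

Lemma jac_inj u : dom c u -> forall v : 'rV_n, v *m jac u = 0 -> v = 0.
Proof.
move=> cu v; rewrite mul_jac -diff_chart //.
have [_ _ /(_ c u hc cu) inj] := hX.
rewrite -[0 in X in X -> _](@row_mx0 _ _ a b).
by move=> /eq_row_mx [v1 v2]; apply: inj; rewrite linear0;
  case: ('d _ _ _) v1 v2 => /= ? ? -> ->.
Qed.

Lemma second_formE u i j :
  second_form X N c u i j = dot (flat (tang2 i j u)) (flat (N (param c u))).
Proof.
have frame2E : partial i (frame X c j) u = tang2 i j u by rewrite tang2E.
rewrite mxE /cyl_connection frame2E /cyl_proj dotE_flat /flat !dot_row_mx /=.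
by rewrite dotBl dotZl (dotC (X _).2) N_tangent mulr0 subr0.
Qed.

(** The gradient of the potential |x|^2 / 4 is x / 2. *)
Lemma f_minimal_mean_curvature u : dom c u ->
  mean_curvature X N c u = dot (X (param c u)).1 (N (param c u)).1 / 2.
Proof.
move=> cu; have := hmin hc cu.
rewrite /weighted_mean_curvature /weighted_mean_curvature_vector.
rewrite /mean_curvature /mean_curvature_vector cyl_grad_potential.
rewrite !dotE_flat /flat !dot_row_mx /= dot0l addr0.
set t := \tr _; set p := param c u.
have := N_unit p; rewrite dotE_flat /flat dot_row_mx => e.
rewrite !(dotDl, dotZl).
move: e; move: (dot (N p).1 _) (dot (N p).2 _) (dot (X p).1 _) => al be s e h.
have {h}ts : t = - (2^-1 * s).
  apply/eqP; rewrite -addr_eq0 -oppr_eq0 -h -[X in - X]mulr1 -e; apply/eqP.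
  by ring.
rewrite ts -mulrDr e. by field.
Qed.

Lemma trace_second_form u : dom c u ->
  \tr (invmx (first_form X c u) *m second_form X N c u)
  = - (dot (X (param c u)).1 (N (param c u)).1 / 2).
Proof.
move=> cu; rewrite -f_minimal_mean_curvature // /mean_curvature.
rewrite /mean_curvature_vector dotE_flat /flat /= dot_row_mx !dotZl -mulrDr.
by rewrite -dot_row_mx -[dot _ _]dotE_flat N_unit mulr1 opprK.
Qed.

(** The unit normal of the cylinder in R^a x R^b. *)
Definition rad (p : M) : 'rV[R]_(a + b) := row_mx 0 (rho^-1 *: (X p).2).

(** Tangent vectors, the normal N of the hypersurface and the normal of the
    cylinder together span R^(a+b). All curvature computations below are
    contractions of this identity. *)
Lemma completeness u : dom c u ->
  (jac u)^T *m invmx (first_form X c u) *m jac u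
  + (flat (N (param c u)))^T *m flat (N (param c u))
  + (rad (param c u))^T *m rad (param c u) = 1%:M.
Proof.
move=> cu; rewrite first_formE; set p := param c u.
have rn : rho != 0 by rewrite gt_eqF.
apply: frame_completeness.
- exact: ab.
- exact: jac_inj.
- by rewrite -dotE_flat.
- rewrite dot_row_mx dot0l add0r dotZl dotZr y_sphere.
  by field.
- by rewrite dot_row_mx dot0r add0r dotZr N_tangent mulr0.
- apply/row_matrixP => i; rewrite row_mul row0 row_jac mx11_mul.
  have [_ _ _ /(_ c u (delta_mx 0 i) hc cu)] := hN.
  rewrite diff_chart // sum_delta_tang dotE_flat dotC => ->.
  by rewrite raddf0.
- apply/row_matrixP => i; rewrite row_mul row0 row_jac mx11_mul.
  rewrite dot_row_mx dot0r add0r dotZr.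
  suff -> : dot (tang i u).2 (X p).2 = 0 by rewrite mulr0 raddf0.
  have := is_derive_snd (is_derive_chart (delta_mx 0 i) cu).
  rewrite sum_delta_tang => dd; have [_] := is_derive_dot dd dd.
  rewrite (_ : (fun x => _) = cst (rho ^+ 2)); last first.
    by apply/funext => v; rewrite y_sphere.
  rewrite derive_cst dotC => /esym /eqP; rewrite -mulr2n mulrn_eq0 /=.
  by move/eqP.
Qed.

(** Half the amount by which |x|^2 falls short of the squared radius 2 (a - 1) of
    the sphere in the conclusion. *)
Definition defect (p : M) : R := a%:R - 1 - dot (X p).1 (X p).1 / 2.

Definition defect_grad (u : 'rV[R]_n) : 'rV[R]_n :=
  \row_j - dot (F u).1 (tang j u).1.

Definition defect_hess (u : 'rV[R]_n) : 'M[R]_n :=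
  \matrix_(i, j) - (dot (tang i u).1 (tang j u).1
                    + dot (F u).1 (tang2 i j u).1).

Lemma is_derive_defect u xi : dom c u ->
  is_derive u xi (defect \o param c) (dot xi (defect_grad u)).
Proof.
move=> cu; have := is_derive_fst (is_derive_chart xi cu); rewrite fst_sum => xd.
have := is_deriveB (is_derive_cst (a%:R - 1 : R) u xi)
  (is_deriveZ 2^-1 (is_derive_dot xd xd)).
rewrite (_ : _ - _ = defect \o param c); last first.
  by apply/funext => v; rewrite /= /defect [in RHS]mulrC.
move=> /is_derive_eq; apply.
rewrite sub0r (dotC _ (F u).1) [_ *: _](_ : _ = dot (F u).1
  (\sum_i xi 0 i *: (tang i u).1)); last by rewrite /GRing.scale /=; field.
rewrite dot_sumr -sumrN; apply: eq_bigr => j _.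
by rewrite mxE mulrN -dotZr.
Qed.

Lemma is_derive_defect_grad u xi eta : dom c u ->
  is_derive u xi (fun v => dot eta (defect_grad v))
    (dot (xi *m defect_hess u) eta).
Proof.
move=> cu; have := is_derive_fst (is_derive_chart xi cu); rewrite fst_sum => xd.
have x1d j : is_derive u xi (fun v => (tang j v).1)
    (\sum_i xi 0 i *: (tang2 i j u).1).
  by have := is_derive_fst (is_derive_tang j xi cu); rewrite fst_sum.
rewrite (_ : (fun v => _) = \sum_(j < n)
   ((- eta 0 j) \*: (fun v => dot (F v).1 (tang j v).1))); last first.
  apply/funext => v; rewrite fct_sumE; apply: eq_bigr => j _.
  by rewrite mxE mulrN -mulNr.
apply: is_derive_eq.
  by apply: is_derive_sum => j; exact: is_deriveZ (is_derive_dot xd (x1d j)).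
apply: eq_bigr => j _; rewrite mxE mulr_suml /GRing.scale /=.
rewrite dot_suml dot_sumr -big_split mulr_sumr.
apply: eq_bigr => i _; rewrite mxE dotZl dotZr.
by move: (dot _ (tang j u).1) (dot _ (tang2 i j u).1) => p q /=; ring.
Qed.

Lemma first_form_sym u : (first_form X c u)^T = first_form X c u.
Proof. by rewrite first_formE trmx_mul trmxK. Qed.

Lemma first_form_unit u : dom c u -> first_form X c u \in unitmx.
Proof. by move=> cu; rewrite first_formE gram_unit //; exact: jac_inj. Qed.

Lemma position_gradE u :
  row_mx (F u).1 0 *m (jac u)^T = - defect_grad u.
Proof.
apply/rowP => i; rewrite dot_mul_jacT dot_row_mx dot0l addr0.
by rewrite !mxE opprK.
Qed.

(** The vector (x, 0) has no component along the normal of the cylinder; its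
    tangential part is the gradient of |x|^2 / 2, that is of - defect. *)
Lemma position_decomposition u : dom c u ->
  row_mx (F u).1 0 =
    - (defect_grad u *m invmx (first_form X c u) *m jac u)
    + dot (F u).1 (N (param c u)).1 *: flat (N (param c u)).
Proof.
move=> cu; rewrite -[LHS]mulmx1 -(completeness cu) !mulmxDr.
rewrite !(mulmxA (row_mx _ _)) !mx11_mul !mul_scalar_mx position_gradE.
rewrite !dot_row_mx !dot0l dot0r !addr0 scale0r addr0.
by rewrite !mulNmx.
Qed.

(** Minus the trace of the Christoffel symbols of the induced metric: the
    first-order coefficients of the Laplacian of M in the chart. *)
Definition drift u : 'rV[R]_n :=
  - ((\sum_i \sum_j invmx (first_form X c u) i j *: flat (tang2 j i u))
     *m (jac u)^T *m invmx (first_form X c u)).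

(** The trace over the tangent space of the projection to R^a: the full trace a
    minus the contribution of the normal N; the cylinder normal has none. *)
Lemma trace_tangential u : dom c u ->
  \sum_i \sum_j invmx (first_form X c u) i j * dot (tang j u).1 (tang i u).1
  = a%:R - dot (N (param c u)).1 (N (param c u)).1.
Proof.
move=> cu; set P := invmx _.
pose E : 'M[R]_(a + b, a) := col_mx 1%:M 0.
have mulE (v1 : 'rV[R]_a) (v2 : 'rV[R]_b) : row_mx v1 v2 *m E = v1.
  by rewrite mul_row_col mulmx1 mulmx0 addr0.
have rowE j : row j (jac u *m E) = (tang j u).1.
  by rewrite row_mul row_jac mulE.
transitivity (\tr (P *m ((jac u *m E) *m (jac u *m E)^T))).
  by rewrite trace_mul_gram; apply: eq_bigr => i _; apply: eq_bigr => j _;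
    rewrite !rowE.
set nu := flat (N (param c u)).
have JPJ : (jac u)^T *m P *m jac u = 1%:M - (rad (param c u))^T *m rad (param c u) - nu^T *m nu.
  by rewrite -(completeness cu) !addrK.
have -> : P *m ((jac u *m E) *m (jac u *m E)^T) = (P *m jac u *m E) *m (E^T *m (jac u)^T).
  by rewrite trmx_mul !mulmxA.
rewrite mxtrace_mulC.
have -> : E^T *m (jac u)^T *m (P *m jac u *m E) = E^T *m ((jac u)^T *m P *m jac u) *m E.
  by rewrite !mulmxA.
rewrite JPJ !(mulmxBr, mulmxBl) mulmx1 -!mulmxA mulE !mulmxA -!trmx_mul !mulE.
rewrite trmx0 mul0mx subr0 linearB /=.
congr (_ - _); last by rewrite -mulmxA mulE mxtrace_mulC mx11_mul mxtrace_scalar.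
by rewrite /E tr_col_mx trmx1 trmx0 mul_row_col mulmx1 mulmx0 addr0 mxtrace1.
Qed.

(** The Laplacian of |x|^2 / 2 is the trace of the projection to R^a over the
    tangent space minus H <x, N>, and H = <x, N> / 2. In coordinates the second
    derivatives of the immersion are contracted with the decomposition of (x, 0):
    the normal part yields the mean curvature and the tangential part a
    first-order term in the gradient of the defect. *)
Lemma laplace_defect u : dom c u ->
  \tr (invmx (first_form X c u) *m defect_hess u) + dot (drift u) (defect_grad u)
  = - (a%:R - dot (N (param c u)).1 (N (param c u)).1)
    + dot (F u).1 (N (param c u)).1 ^+ 2 / 2.
Proof.
move=> cu; rewrite -(trace_tangential cu).
set P := invmx _; set nu := N _; set s := dot (F u).1 nu.1.
pose Z : 'rV[R]_(a + b) := \sum_i \sum_j P i j *: flat (tang2 j i u).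
have T2 : \sum_i \sum_j P i j * dot (F u).1 (tang2 j i u).1
    = - dot (defect_grad u *m P *m jac u) Z - s ^+ 2 / 2.
  transitivity (dot (row_mx (F u).1 0) Z).
    rewrite dot_sumr; apply: eq_bigr => i _; rewrite dot_sumr.
    by apply: eq_bigr => j _; rewrite dotZr dot_row_mx dot0l addr0.
  rewrite position_decomposition // -/P -/nu -/s dotDl dotNl dotZl; congr (_ + _).
  rewrite (_ : dot (flat nu) Z = - (s / 2)); first by rewrite expr2; field.
  rewrite -[RHS](trace_second_form cu) dot_sumr; apply: eq_bigr => i _.
  rewrite mxE dot_sumr; apply: eq_bigr => j _.
  by rewrite dotZr second_formE dotC.
have drE : dot (drift u) (defect_grad u) = - dot (defect_grad u *m P *m jac u) Z.
  rewrite /drift -/P -/Z dotNl -[Z *m _ *m P]mulmxA [in LHS]dot_mulmxl.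
  by rewrite trmx_mul trmxK trmx_inv first_form_sym mulmxA dotC.
have trE : \tr (P *m defect_hess u)
    = - (\sum_i \sum_j P i j * dot (tang j u).1 (tang i u).1)
      - \sum_i \sum_j P i j * dot (F u).1 (tang2 j i u).1.
  rewrite -opprD -big_split -sumrN; apply: eq_bigr => i _.
  rewrite mxE -big_split -sumrN; apply: eq_bigr => j _.
  rewrite mxE; move: (dot _ (tang i u).1) (dot _ (tang2 j i u).1) => p q /=.
  by ring.
have comb (t1 t2 q r tr dr : R) : tr = - t1 - t2 -> dr = - q ->
    t2 = - q - r ^+ 2 / 2 -> tr + dr = - t1 + r ^+ 2 / 2.
  by move=> -> -> ->; ring.
exact: comb trE drE T2.
Qed.

Lemma cvg_jac u : dom c u -> jac @ u --> jac u.
Proof.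
move=> cu; apply: (@cvg_mx R _ (nbhs u)) => i j; rewrite mxE.
under eq_fun do rewrite mxE.
by apply: cvg_coord; apply: cvg_flat; exact: cvg_tang.
Qed.

Lemma cvg_inv_first_form u : dom c u ->
  (fun v => invmx (first_form X c v)) @ u --> invmx (first_form X c u).
Proof.
move=> cu; apply: (@cvg_invmx R _ (nbhs u)).
- exact: first_form_unit.
- by apply: filterS (dom_open cu) => v; exact: first_form_unit.
rewrite (funext first_formE) /=; have Jc := cvg_jac cu.
exact: (cvg_mulmx Jc (cvg_trmx Jc)).
Qed.

Lemma cvg_drift u : dom c u -> drift @ u --> drift u.
Proof.
move=> cu; have Pc := cvg_inv_first_form cu.
have Tc j i : (fun v => flat (tang2 j i v)) @ u --> flat (tang2 j i u).
  apply: (@cvg_flat R _ (nbhs u) _ a b (tang2 j i)).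
  exact: cvg_tang2.
have Zc : (\sum_i \sum_j invmx (first_form X c v) i j *: flat (tang2 j i v))
    @[v --> u] --> \sum_i \sum_j invmx (first_form X c u) i j *: flat (tang2 j i u).
  apply: (@cvg_sum_ord R _ (nbhs u)) => i; apply: (@cvg_sum_ord R _ (nbhs u)) => j.
  exact: (cvgZ (cvg_coord Pc) (Tc j i)).
exact: (cvgN (cvg_mulmx (cvg_mulmx Zc (cvg_trmx (cvg_jac cu))) Pc)).
Qed.

Lemma defect_continuous u : dom c u -> (defect \o param c) @ u --> (defect \o param c) u.
Proof.
move=> cu; have Fc : F @ u --> F u by exact: (Cinfty_continuous chart_smooth).
have xc : (F v).1 @[v --> u] --> (F u).1.
  exact: (@cvg_comp _ _ _ F fst _ _ _ Fc (@cvg_fst _ _ (nbhs (F u).1) (nbhs (F u).2) _)).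
exact: (cvgB (cvg_cst _) (cvgMr_tmp (cvg_dot xc xc))).
Qed.

Lemma trace_inv_first_form_ge0 u : dom c u -> forall S : 'M[R]_n,
  (forall xi : 'rV[R]_n, 0 <= dot (xi *m S) xi) ->
  0 <= \tr (invmx (first_form X c u) *m S).
Proof.
move=> cu S; apply: trace_invmx_ge0; first exact: first_form_sym.
by rewrite first_formE; apply: gram_posdef; exact: jac_inj.
Qed.

Lemma inv_first_form_pos u : dom c u -> forall xi : 'rV[R]_n,
  xi != 0 -> 0 < dot (xi *m invmx (first_form X c u)) xi.
Proof.
move=> cu xi xi0; set G := first_form X c u.
have Gu : G \in unitmx by exact: first_form_unit.
rewrite -[X in dot _ X](mulmxKV Gu) dotC.
set eta := xi *m invmx G.
have -> : dot (eta *m G) eta = dot (eta *m (jac u *m (jac u)^T)) eta.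
  by rewrite /G first_formE.
apply: gram_posdef; first exact: jac_inj.
by apply: contra_neq xi0 => e0; rewrite -[xi](mulmxKV Gu) -/eta e0 mul0mx.
Qed.

End Hypersurface.
(** * The Euclidean factor of the immersion has constant length *)

Section ManifoldTopology.
Context {R : realType} {n : nat} {M : topologicalType} (A : smooth_atlas R n M).

Lemma near_chart (c : chart R n M) p (P : set M) : cod c p ->
  (\forall v \near Defs.coord c p, P (param c v)) -> \forall q \near p, P q.
Proof.
move=> cp nearP; have cc := @Defs.coord_continuous _ _ _ c p cp.
have near1 : \forall q \near p, P (param c (Defs.coord c q)) by exact: (cc _ nearP).
have near2 : \forall q \near p, cod c q.
  by have := cod_open c; rewrite openE => /(_ _ cp).
by apply: filterS2 near1 near2 => q + cq; rewrite coordK.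
Qed.

Lemma smooth_map_is_continuous (W : normedModType R) (f : M -> W) :
  smooth_map A f -> continuous f.
Proof.
move=> fs p; have [c hc cp] := charts_cover A p.
have cu := coord_dom cp.
have fc : (f \o param c) @ Defs.coord c p --> f p.
  by rewrite -[in f p](coordK cp); exact: (Cinfty_continuous (fs _ hc) cu).
move=> V /fc nV.
exact: (near_chart cp nV).
Qed.

End ManifoldTopology.

Section ConstantRadius.
Context {R : realType} {n a b : nat} (ab : (a + b = n.+2)%N) (a2 : (1 < a)%N).
Context {M : topologicalType} (A : smooth_atlas R n M) (rho : R) (rho0 : 0 < rho).
Hypothesis M_connected : connected [set: M].
Variables X N : M -> 'rV[R]_a * 'rV[R]_b.
Hypothesis hX : immersion_in_cylinder A rho X.
Hypothesis hN : unit_normal_field A X N.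
Hypothesis hmin : f_minimal A X N.
Hypothesis hNout : outward_oriented X N.
Hypothesis hH : forall c u, charts A c -> dom c u ->
  mean_curvature X N c u <= Num.sqrt (2 * (a%:R - 1)) / 2.

Let N1_le1 p : dot (N p).1 (N p).1 <= 1.
Proof.
have [_ _ /(_ p) <- _] := hN.
by rewrite dotE_flat dot_row_mx lerDl dot_ge0.
Qed.

Let a1 : 1 < a%:R :> R. Proof. by rewrite ltr1n. Qed.

Lemma normal_position c u : charts A c -> dom c u -> defect_grad X c u = 0 ->
  (X (param c u)).1 = dot (X (param c u)).1 (N (param c u)).1 *: (N (param c u)).1
  /\ dot (X (param c u)).1 (N (param c u)).1 *: (N (param c u)).2 = 0.
Proof.
move=> hc cu g0; have := position_decomposition ab rho0 hX hN hc cu.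
rewrite g0 !mul0mx oppr0 add0r /flat scale_row_mx => /eq_row_mx [E1 E2].
by split; [exact: E1 | exact/esym/E2].
Qed.

Lemma defect_local_min c u : charts A c -> dom c u ->
  (forall q, defect X (param c u) <= defect X q) ->
  defect_grad X c u = 0 /\
  0 <= \tr (invmx (first_form X c u) *m defect_hess X c u).
Proof.
move=> hc cu umin.
have [|||g0 hpsd] := @second_derivative_test R n (defect X \o param c)
    (defect_grad X c) (defect_hess X c u) u.
- apply: filterS (dom_open cu) => v cv xi; exact: (is_derive_defect hX hc).
- move=> xi; exact: (is_derive_defect_grad hX hc).
- by apply: filterS (dom_open cu) => v cv; exact: umin.
split=> //; exact: (trace_inv_first_form_ge0 hX hc).
Qed.

(** If x vanished identically, the projection of the tangent spaces to R^a would
    be 0, while its trace is at least a - 1. *)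
Lemma position_not_all0 : exists q, (X q).1 != 0.
Proof.
apply: contrapT => X0; have {}X0 q : (X q).1 = 0.
  by apply/eqP/negPn/negP => q0; apply: X0; exists q.
have [p _] := hNout; have [c hc cp] := charts_cover A p.
have cu := coord_dom cp; set u := Defs.coord c p in cu.
have tang0 i : (tang X c i u).1 = 0.
  have := is_derive_fst (is_derive_chart hX hc (delta_mx 0 i) cu).
  rewrite sum_delta_tang => -[_ <-].
  rewrite (_ : (fun x => _) = cst 0) ?derive_cst //.
  by apply/funext => v; exact: X0.
have := trace_tangential ab rho0 hX hN hc cu.
rewrite [X in X = _](_ : _ = 0) => [/esym/eqP|]; last first.
  by apply: big1 => i _; apply: big1 => j _; rewrite (tang0 j) dot0l mulr0.
rewrite subr_eq0 => /eqP aE; have := N1_le1 (param c u); rewrite -aE.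
by rewrite leNgt a1.
Qed.

(** Look at a point where |x| is maximal. There x is normal, so N = (x / |x|, 0) by
    the choice of orientation and H = |x| / 2; the bound on H gives
    |x|^2 <= 2 (a - 1). Conversely the Laplacian of the defect is nonnegative at
    its minimum, which gives the reverse inequality. *)
Lemma defect_ge0_attains0 : (forall q, 0 <= defect X q) /\ exists p, defect X p = 0.
Proof.
have [p [pmax pout]] := hNout; have [c hc cp] := charts_cover A p.
have cu := coord_dom cp; set u := Defs.coord c p in cu.
have pE : param c u = p by exact: coordK.
have pmax' q : dot (X q).1 (X q).1 <= dot (X p).1 (X p).1.
  by rewrite -!enormK ler_pXn2r ?nnegrE ?sqrtr_ge0 //; exact: pmax.
have dmin q : defect X p <= defect X q.
  by rewrite /defect lerD2l lerN2 ler_wpM2r ?invr_ge0.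
have [|g0 tr0] := defect_local_min hc cu; first by rewrite pE.
have [x1 x2] := normal_position hc cu g0; rewrite pE in x1 x2.
set s := dot (X p).1 (N p).1 in x1 x2 pout.
have s0 : s != 0.
  have [q] := position_not_all0; apply: contra_neq => s0.
  apply/eqP; rewrite -dot_eq0 eq_le dot_ge0 andbT.
  by rewrite (le_trans (pmax' q)) // x1 s0 scale0r dot0l.
have N20 : (N p).2 = 0 by apply/eqP; move/eqP: x2; rewrite scaler_eq0 (negPf s0).
have N11 : dot (N p).1 (N p).1 = 1.
  by have [_ _ /(_ p) + _] := hN; rewrite dotE_flat dot_row_mx N20 dot0l addr0.
have xx : dot (X p).1 (X p).1 = s ^+ 2.
  by rewrite x1 dotZl dotZr N11 mulr1 expr2.
have sle : s ^+ 2 <= 2 * (a%:R - 1).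
  have := hH hc cu; rewrite (f_minimal_mean_curvature hN hmin hc cu) pE -/s.
  rewrite ler_pM2r ?invr_gt0 // => h.
  have a10 : 0 <= 2 * (a%:R - 1) :> R by rewrite mulr_ge0 // subr_ge0 ltW.
  by rewrite -(sqr_sqrtr a10) ler_pXn2r ?nnegrE ?sqrtr_ge0.
have dp : defect X p = a%:R - 1 - s ^+ 2 / 2 by rewrite /defect xx.
have sge : 0 <= - (a%:R - 1) + s ^+ 2 / 2.
  have := laplace_defect ab rho0 hX hN hmin hc cu.
  rewrite g0 dot0r addr0 pE N11 /= pE -/s => <-; exact: tr0.
split; last by exists p; rewrite dp; lra.
by move=> q; rewrite (le_trans _ (dmin q)) // dp; lra.
Qed.

(** As |x|^2 <= 2 (a - 1), the Cauchy-Schwarz inequality makes the Laplacian of the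
    defect nonpositive. The strong minimum principle then shows that the zero set
    of the defect is open; it is closed and nonempty. *)
Lemma defect_eq0 q : defect X q = 0.
Proof.
have [d0 [p dp]] := defect_ge0_attains0.
have Xc : continuous X by have [Xs _ _] := hX; exact: (smooth_map_is_continuous Xs).
have dc : continuous (defect X).
  move=> r; have xc : (X v).1 @[v --> r] --> (X r).1.
    exact: (@cvg_comp _ _ _ X fst _ _ _ (Xc r)
      (@cvg_fst _ _ (nbhs (X r).1) (nbhs (X r).2) _)).
  exact: (cvgB (cvg_cst _) (cvgMr_tmp (cvg_dot xc xc))).
pose Z := defect X @^-1` [set 0].
suff ZT : Z = setT.
  have Zq : Z q by rewrite ZT.
  exact: Zq.
apply: M_connected.
- by exists p.
- exists Z; last by rewrite setTI.
  rewrite openE => r /= Zr; have [c hc cr] := charts_cover A r.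
  have cu := coord_dom cr.
  apply: (near_chart cr).
  apply: (@strong_minimum_principle R n (dom c) (fun u => invmx (first_form X c u))
    (drift X c) (defect_grad X c) (defect X \o param c) (defect_hess X c)) => //.
  + exact: dom_open.
  + move=> u; exact: (cvg_inv_first_form hX hc).
  + move=> u; exact: (cvg_drift hX hc).
  + move=> u; exact: (trace_inv_first_form_ge0 hX hc).
  + move=> u; exact: (inv_first_form_pos hX hc).
  + move=> u; exact: (defect_continuous hX hc).
  + move=> u xi; exact: (is_derive_defect hX hc).
  + move=> u xi eta; exact: (is_derive_defect_grad hX hc).
  + by move=> u _; exact: d0.
  + move=> u cv; rewrite (laplace_defect ab rho0 hX hN hmin hc cv) /=.
    set t := dot (N _).1 _; set s := dot _ (N _).1.
    have cs := cauchy_schwarz (X (param c u)).1 (N (param c u)).1.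
    have := d0 (param c u); rewrite /defect.
    move: cs; rewrite -/s -/t; set x := dot (X _).1 _ => cs xle.
    have t1 : t <= 1 by exact: N1_le1.
    have t0 : 0 <= t by exact: dot_ge0.
    have xt : x * t <= 2 * (a%:R - 1) * t by rewrite ler_wpM2r //; lra.
    have at1 : a%:R * t <= a%:R by rewrite ler_piMr // ler0n.
    by lra.
  + by rewrite /= coordK.
- exists Z; last by rewrite setTI.
  by apply: preimage_closed; [move=> r _; exact: dc | exact: closed_eq].
Qed.

Lemma radius_constant p : dot (X p).1 (X p).1 = 2 * (a%:R - 1).
Proof. by have := defect_eq0 p; rewrite /defect; lra. Qed.

End ConstantRadius.
(** * Lifting homotopies through local homeomorphisms *)

(** A property that is open and closed relatively to a connected set holds on all
    of it as soon as it holds at one point. *)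
Lemma connected_propagate (T : topologicalType) (A : set T) (P : T -> Prop) :
  connected A ->
  (forall t, A t -> P t -> \forall s \near t, A s -> P s) ->
  (forall t, A t -> ~ P t -> \forall s \near t, A s -> ~ P s) ->
  forall s t, A s -> A t -> P s -> P t.
Proof.
move=> Ac Po Pc s t As At Ps.
suff E : A `&` P = A by have [] : (A `&` P) t by rewrite E.
apply: Ac; first by exists s.
- exists [set u | A u -> P u]°; first exact: open_interior.
  apply/seteqP; split=> u [Au]; first by move=> Pu; split=> //; exact: Po.
  by move=> /interior_subset /(_ Au).
- exists (~` [set u | A u -> ~ P u]°).
    by apply: open_closedC; exact: open_interior.
  apply/seteqP; split=> u [Au].
    by move=> Pu; split=> // /interior_subset /(_ Au).
  by move=> Nu; split=> //; apply: contrapT => NPu; apply: Nu; exact: Pc.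
Qed.

Section Lifting.
Context {R : realType} {E : normedModType R} {M : topologicalType}.
Variables (X : M -> E) (T : set E).
Hypothesis M_compact : compact [set: M].
Hypothesis M_hausdorff : hausdorff_space M.
Hypothesis Xc : continuous X.
Hypothesis Xinj : forall p : M, exists2 V : set M, nbhs p V &
  forall q q', V q -> V q' -> X q = X q' -> q = q'.
Hypothesis Xopen : forall (p : M) (V : set M), nbhs p V -> exists2 d : R, 0 < d &
  forall q, T q -> `|q - X p| < d -> exists2 p', V p' & X p' = q.

(** A compact Hausdorff space has a neighborhood B of the diagonal whose sections
    all lie in open sets on which X is injective: near p the relation
    (closure K z.1 -> V z.2) will do, where V is such an open set around p and K a
    smaller neighborhood with closure in V, and compactness makes the choice
    uniform in p. *)
Lemma uniform_injectivity : exists B : set (M * M),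
  [/\ open B, forall p, B (p, p) &
      forall p p' p'', B (p, p') -> B (p, p'') -> X p' = X p'' -> p' = p''].
Proof.
pose small (B : set (M * M)) := open B /\ forall p, B (p, p).
pose F := filter_from small (fun B => [set B' : set (M * M) | B' `<=` B]).
have FF : Filter F.
  apply: filter_from_filter.
    by exists setT; split=> //; exact: openT.
  move=> B1 B2 [Bo1 Bd1] [Bo2 Bd2]; exists (B1 `&` B2).
    by split; [exact: openI | move=> p; split].
  by move=> B' sub; split=> z /sub [].
pose P (B : set (M * M)) p := forall p' p'', B (p, p') -> B (p, p'') ->
  X p' = X p'' -> p' = p''.
have := (compact_near_coveringP _).1 M_compact _ F P FF.
case=> [p _|B [Bo Bd] /(_ B (@subset_refl _ _)) BP].
  have [V nV Vinj] := Xinj p.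
  have [K nK KV] : filter_from (nbhs p) closure V°.
    apply: (@compact_regular M p setT M_hausdorff M_compact filterT).
    exact: nbhs_interior.
  exists (K, [set B' | B' `<=` [set z | closure K z.1 -> V° z.2]]) => /=.
    split=> //.
    exists [set z : M * M | closure K z.1 -> V° z.2] => //; split.
      rewrite (_ : [set z | _] = (fst @^-1` ~` closure K) `|` (snd @^-1` V°)).
        apply: openU; apply: open_comp.
        - by move=> z _; exact: cvg_fst.
        - by apply: closed_openC; exact: closed_closure.
        - by move=> z _; exact: cvg_snd.
        - exact: open_interior.
      apply/seteqP; split=> z /=.
        by case: (pselect (closure K z.1)) => [Kz /(_ Kz)|]; [right|left].
      by case=> [Nz /Nz|].
    by move=> q /= /KV.
  move=> [q B'] /= [Kq sub] q' q'' h1 h2.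
  have Kq' : closure K q by exact: subset_closure.
  by apply: Vinj; apply: interior_subset; [exact: (sub _ h1) | exact: (sub _ h2)].
by exists B; split=> // p p' p''; apply: BP.
Qed.

Lemma uniform_lift (B : set (M * M)) : open B -> (forall p, B (p, p)) ->
  exists2 e : R, 0 < e &
    forall p q, T q -> `|q - X p| < e -> exists2 p', B (p, p') & X p' = q.
Proof.
move=> Bo Bd.
pose P (e : R) p := forall q, T q -> `|q - X p| < e ->
  exists2 p', B (p, p') & X p' = q.
have := (compact_near_coveringP _).1 M_compact _ (nbhs (0 : R)^'+) P _.
case=> [p _|e /= e0 eP].
  have [[W V] /= [nW nV] WV] : nbhs (p, p) B by move: Bo; rewrite openE; apply.
  have [d d0 dP] := Xopen nV.
  have d20 : 0 < d / 2 by rewrite divr_gt0.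
  exists (W `&` [set q | `|X p - X q| < d / 2], [set e | e < d / 2]) => /=.
    split; last exact: nbhs_right_lt.
    apply: filterI => //.
    have Xcp : X @ p --> X p by exact: Xc.
    by move/cvgrPdist_lt: Xcp => /(_ _ d20).
  move=> [p1 e1] /= [[Wp1 p1d] e1d] q Tq qe.
  have [|p' Vp' <-] := dP q Tq.
    rewrite -[q - X p](subrKA (X p1)) (le_lt_trans (ler_normD _ _)) //.
    rewrite (splitr d); apply: ltrD; first exact: lt_trans qe e1d.
    by rewrite distrC.
  by exists p' => //; apply: WV.
have e20 : 0 < e / 2 by rewrite divr_gt0.
exists (e / 2) => // p; apply: (eP (e / 2)) => //=.
by rewrite sub0r normrN gtr0_norm // ltr_pdivrMr // ltr_pMr // ltr1n.
Qed.

Section Lifts.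
Variables (Y : topologicalType) (D : set Y).

Definition lift_on (g : Y -> E) (sigma : Y -> M) :=
  forall y, D y -> {for y, continuous sigma} /\ X (sigma y) = g y.

Hypothesis Do : open D.

(** Homotopy lifting in one small step: the value of the new lift at y is the only
    preimage of g1 y that is close to the old lift in the sense of
    [uniform_injectivity]. *)
Lemma lift_step : exists2 e : R, 0 < e &
  forall g0 g1 sigma0, lift_on g0 sigma0 ->
  (forall y, D y -> {for y, continuous g1}) -> (forall y, D y -> T (g1 y)) ->
  (forall y, D y -> `|g1 y - g0 y| < e) ->
  exists2 sigma1, lift_on g1 sigma1 &
    forall y, D y -> g1 y = g0 y -> sigma1 y = sigma0 y.
Proof.
have [B [Bo Bd Binj]] := uniform_injectivity.
have [e e0 eP] := uniform_lift Bo Bd; exists e => // g0 g1 s0 s0P g1c g1T g01.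
have /choice[s1 s1P] : forall y, exists p, D y -> B (s0 y, p) /\ X p = g1 y.
  move=> y; have [Dy|nDy] := pselect (D y); last by exists (s0 y).
  have [|p' Bp' Xp'] := eP (s0 y) (g1 y) (g1T _ Dy).
    by rewrite (s0P _ Dy).2; exact: g01.
  by exists p'.
exists s1 => [y Dy|y Dy g10]; last first.
  have [By Xy] := s1P _ Dy; apply: (Binj _ _ _ By (Bd _)).
  by rewrite Xy (s0P _ Dy).2.
have [By Xy] := s1P _ Dy; split=> // V' nV'.
have [[W V] /= [nW nV] WV] : nbhs (s0 y, s1 y) B.
  by move: Bo; rewrite openE; apply.
have [d d0 dP] := Xopen (filterI nV nV').
have near1 : \forall z \near y, W (s0 z) by exact: ((s0P _ Dy).1 _ nW).
have near2 : \forall z \near y, `|g1 z - X (s1 y)| < d.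
  rewrite Xy; have /cvgrPdist_lt /(_ _ d0) := g1c _ Dy.
  by apply: filterS => z; rewrite distrC.
have near3 : \forall z \near y, D z by move: Do; rewrite openE; apply.
apply: filterS3 near1 near2 near3 => z Wz gz Dz.
have [p' [Vp' V'p'] Xp'] := dP _ (g1T _ Dz) gz.
have [Bz Xz] := s1P _ Dz.
suff E1 : s1 z = p' by rewrite -E1 in V'p'.
by apply: (Binj _ _ _ Bz (WV (_, _) (conj Wz Vp'))); rewrite Xz.
Qed.

(** A homotopy that is Lipschitz in time splits into finitely many small steps, each
    lifted by the previous lemma. Points that the homotopy does not move keep
    their lift, which is what makes it possible to compare two lifts later. *)
Lemma lift_homotopy (g : R -> Y -> E) (L : R) (sigma0 : Y -> M) :
  (forall (t : R) y, 0 <= t <= 1 -> D y -> {for y, continuous (g t)}) ->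
  (forall (t : R) y, 0 <= t <= 1 -> D y -> T (g t y)) ->
  (forall (s t : R) y, 0 <= s <= 1 -> 0 <= t <= 1 -> D y ->
     `|g s y - g t y| <= L * `|s - t|) ->
  lift_on (g 0) sigma0 ->
  exists2 sigma1, lift_on (g 1) sigma1 &
    forall y, D y -> (forall t : R, 0 <= t <= 1 -> g t y = g 0 y) ->
      sigma1 y = sigma0 y.
Proof.
move=> gc gT gL s0P; have [e e0 step] := lift_step.
pose K := (Num.truncn (`|L| / e)).+1.
have KL : `|L| / K%:R < e.
  rewrite ltr_pdivrMr ?ltr0n // mulrC -ltr_pdivrMr //.
  by rewrite truncnS_gt.
have K0 : 0 < K%:R :> R by rewrite ltr0n.
have inK k : (k <= K)%N -> 0 <= (k%:R / K%:R : R) <= 1.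
  by move=> kK; rewrite divr_ge0 ?ler0n // ler_pdivrMr // mul1r ler_nat.
suff : forall k, (k <= K)%N -> exists2 s, lift_on (g (k%:R / K%:R)) s &
    forall y, D y -> (forall t : R, 0 <= t <= 1 -> g t y = g 0 y) -> s y = sigma0 y.
  by move=> /(_ K (leqnn _)); rewrite divff // gt_eqF.
elim=> [_|k IHk kK]; first by rewrite mul0r; exists sigma0.
have [s sP seq] := IHk (ltnW kK).
have [|||s' s'P s'eq] := step _ (g (k.+1%:R / K%:R)) _ sP.
- by move=> y Dy; apply: gc => //; exact: inK.
- by move=> y Dy; apply: gT => //; exact: inK.
- move=> y Dy; apply: le_lt_trans KL.
  apply: (le_trans (gL _ _ _ (inK _ kK) (inK _ (ltnW kK)) Dy)).
  rewrite -mulrBl -natrB // subSn // subnn mul1r normfV ger0_norm ?ler0n //.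
  by rewrite ler_pM2r ?invr_gt0 // ler_norm.
exists s' => // y Dy yc; rewrite s'eq ?seq //.
by rewrite yc ?(inK _ kK) // [RHS]yc // inK // ltnW.
Qed.

(** The set where two lifts agree is open because X is locally injective, and
    closed because M is Hausdorff. *)
Lemma lift_unique g sigma tau (A : set Y) :
  lift_on g sigma -> lift_on g tau -> connected A -> A `<=` D ->
  forall y z, A y -> A z -> sigma y = tau y -> sigma z = tau z.
Proof.
move=> sP tP Ac AD.
apply: (connected_propagate Ac) => y Ay Py.
  have [V nV Vinj] := Xinj (sigma y).
  have [sc _] := sP _ (AD _ Ay); have [tc _] := tP _ (AD _ Ay).
  have n1 : \forall z \near y, V (sigma z) by exact: (sc _ nV).
  have n2 : \forall z \near y, V (tau z) by rewrite Py in nV; exact: (tc _ nV).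
  apply: filterS2 n1 n2 => z Vs Vt Az.
  by apply: Vinj => //; rewrite (sP _ (AD _ Az)).2 (tP _ (AD _ Az)).2.
move/eqP: Py; move: M_hausdorff; rewrite open_hausdorff => H.
move=> /H [[U V] /= [Us Vt] [Uo Vo /eqP UV]]; rewrite !inE in Us Vt.
have [sc _] := sP _ (AD _ Ay); have [tc _] := tP _ (AD _ Ay).
have n1 : \forall z \near y, U (sigma z) by apply: sc; exact: open_nbhs_nbhs.
have n2 : \forall z \near y, V (tau z) by apply: tc; exact: open_nbhs_nbhs.
apply: filterS2 n1 n2 => z Uz Vz Az E0.
by have : (U `&` V) (tau z) by [split=> //; rewrite -E0]; rewrite UV.
Qed.

End Lifts.
End Lifting.
(** * Lifting over spheres *)

Section UnitVectors.
Context {R : realType} {m : nat}.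
Implicit Types u v w : 'rV[R]_m.

Definition nrm v : 'rV[R]_m := (enorm v)^-1 *: v.

Lemma enorm_gt0 v : (0 < enorm v) = (v != 0).
Proof. by rewrite sqrtr_gt0 dot_gt0. Qed.

Lemma dot_nrml v w : dot (nrm v) w = dot v w / enorm v.
Proof. by rewrite dotZl mulrC. Qed.

Lemma nrm_unit v : v != 0 -> dot (nrm v) (nrm v) = 1.
Proof.
move=> v0; have e0 : enorm v != 0 by rewrite gt_eqF // enorm_gt0.
by rewrite dotZl dotZr -enormK; field.
Qed.

Lemma scale_nrm r v : 0 < r -> dot v v = r ^+ 2 -> r *: nrm v = v.
Proof.
move=> r0 vr; have -> : nrm v = r^-1 *: v.
  by rewrite /nrm /enorm vr sqrtr_sqr gtr0_norm.
by rewrite scalerA divff ?scale1r // gt_eqF.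
Qed.

Lemma nrm_id v : dot v v = 1 -> nrm v = v.
Proof. by move=> v1; rewrite -[RHS](@scale_nrm 1) ?scale1r // v1 expr1n. Qed.

Lemma enormZ k v : enorm (k *: v) = `|k| * enorm v.
Proof.
by rewrite /enorm dotZl dotZr mulrA -expr2 sqrtrM ?sqr_ge0 // sqrtr_sqr.
Qed.

(** Squared, the inequality reads 2 - 2 c <= (|v|^2 + |w|^2 - 2 c |v| |w|) / k^2,
    where c is the cosine of the angle between v and w; and k^2 <= |v| |w|. *)
Lemma nrm_lipschitz k v w : 0 < k -> k ^+ 2 <= dot v v -> k ^+ 2 <= dot w w ->
  enorm (nrm v - nrm w) <= enorm (v - w) / k.
Proof.
move=> k0 kv kw.
have k20 : 0 < k ^+ 2 by rewrite exprn_gt0.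
have v0 : v != 0 by rewrite -dot_gt0 (lt_le_trans k20).
have w0 : w != 0 by rewrite -dot_gt0 (lt_le_trans k20).
have ev : k <= enorm v by rewrite -(ler_pXn2r (_ : 0 < 2)%N) ?nnegrE ?sqrtr_ge0 ?(ltW k0) // enormK.
have ew : k <= enorm w by rewrite -(ler_pXn2r (_ : 0 < 2)%N) ?nnegrE ?sqrtr_ge0 ?(ltW k0) // enormK.
rewrite -(ler_pXn2r (_ : 0 < 2)%N) ?nnegrE ?divr_ge0 ?sqrtr_ge0 ?(ltW k0) //.
rewrite expr_div_n !enormK !(dotBl, dotBr) !nrm_unit // (dotC (nrm w)) (dotC w v).
have e1 : 0 < enorm v by rewrite enorm_gt0.
have e2 : 0 < enorm w by rewrite enorm_gt0.
have -> : dot (nrm v) (nrm w) = dot v w / (enorm v * enorm w).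
  by rewrite dotZl dotZr; field; rewrite !gt_eqF.
have cs := cauchy_schwarz v w.
rewrite ler_pdivlMr //; rewrite -(enormK v) -(enormK w) in cs *.
move: (enorm v) (enorm w) (dot v w) cs e1 e2 ev ew.
move=> x y d cs x0 y0 kx ky.
pose c := d / (x * y).
have dE : d = c * (x * y) by rewrite /c divfK // mulf_neq0 ?gt_eqF.
have c1 : c <= 1.
  rewrite /c ler_pdivrMr ?mulr_gt0 // mul1r (le_trans (ler_norm d)) //.
  rewrite -(ler_pXn2r (_ : 0 < 2)%N) ?nnegrE ?normr_ge0 ?mulr_ge0 ?(ltW x0) ?(ltW y0) //.
  by rewrite real_normK ?num_real // exprMn.
have kxy : k ^+ 2 <= x * y by rewrite expr2 ler_pM // ltW.
have h1 : 0 <= (1 - c) * (x * y - k ^+ 2) by rewrite mulr_ge0 // subr_ge0.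
have h2 : 0 <= (x - y) ^+ 2 by exact: sqr_ge0.
by rewrite -/c dE; nra.
Qed.

Lemma continuous_enorm : continuous (@enorm R m).
Proof.
move=> v; apply: (@continuous_comp _ _ _ (fun v => dot v v) Num.sqrt v).
  exact: (cvg_dot (@cvg_id _ (nbhs v)) (@cvg_id _ (nbhs v))).
exact: sqrt_continuous.
Qed.

Lemma continuous_nrm v : v != 0 -> {for v, continuous nrm}.
Proof.
move=> v0; have ec : enorm w @[w --> v] --> enorm v by exact: continuous_enorm.
have en0 : enorm v != 0 by rewrite gt_eqF // enorm_gt0.
exact: (cvgZ (cvgV en0 ec) (@cvg_id _ (nbhs v))).
Qed.

(** The kernel of B^T has dimension at least m - n. *)
Lemma exists_unit_orthogonal n (B : 'M[R]_(n, m)) : (n < m)%N ->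
  exists z, dot z z = 1 /\ z *m B^T = 0.
Proof.
move=> nm; have /rowV0Pn[v /sub_kermxP vB v0] : kermx B^T != 0.
  rewrite -mxrank_eq0 mxrank_ker -lt0n subn_gt0.
  exact: leq_ltn_trans (rank_leq_col _) nm.
exists (nrm v); split; first exact: nrm_unit.
by rewrite -scalemxAl vB scaler0.
Qed.

Lemma exists_unit_orthogonal1 u : (1 < m)%N -> exists z, dot z z = 1 /\ dot z u = 0.
Proof.
move=> m1; have [z [z1 zu]] := exists_unit_orthogonal u m1.
by exists z; split=> //; rewrite dot_mulmx zu mxE.
Qed.

Lemma enorm_triangle_unit u v : dot u u = 1 -> dot v v = 1 -> enorm (u - v) <= 2.
Proof.
move=> u1 v1; rewrite -(ler_pXn2r (_ : 0 < 2)%N) ?nnegrE ?sqrtr_ge0 //.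
have := dot_ge0 (u + v); rewrite enormK !(dotDl, dotDr, dotNl, dotNr) u1 v1.
by rewrite (dotC v u) expr2; lra.
Qed.

End UnitVectors.

Section SphereLift.
Context {R : realType} {E : normedModType R} {M : topologicalType}.
Variables (X : M -> E) (T : set E).
Hypothesis M_compact : compact [set: M].
Hypothesis M_hausdorff : hausdorff_space M.
Hypothesis Xc : continuous X.
Hypothesis Xinj : forall p : M, exists2 V : set M, nbhs p V &
  forall q q', V q -> V q' -> X q = X q' -> q = q'.
Hypothesis Xopen : forall (p : M) (V : set M), nbhs p V ->
  exists2 d : R, 0 < d &
  forall q, T q -> `|q - X p| < d -> exists2 p', V p' & X p' = q.

Context {a : nat} {Y : topologicalType} (W : set Y) (Wo : open W).
Variables (G : 'rV[R]_a -> Y -> E) (L : R).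
Hypothesis L0 : 0 <= L.
Hypothesis GT : forall u y, dot u u = 1 -> W y -> T (G u y).
Hypothesis GL : forall u u' y, dot u u = 1 -> dot u' u' = 1 -> W y ->
  `|G u y - G u' y| <= L * enorm (u - u').
Hypothesis Gc : forall (v : 'rV[R]_a) y, v != 0 -> W y ->
  {for (v, y), continuous (fun z : 'rV[R]_a * Y => G (nrm z.1) z.2)}.

(** An open cone in place of a spherical cap, so that maps on it are maps on an open
    set of a vector space. Its complement is a cone of directions around - u. With
    the constant 3/4 the caps of two orthogonal directions cover everything, since
    2 (3/4)^2 > 1, while segments from u to a unit vector of its cap stay away
    from 0. *)
Definition cap (u : 'rV[R]_a) : set 'rV[R]_a :=
  [set v | - (3 / 4) * enorm v < dot v u].

Lemma cap_neq0 u v : cap u v -> v != 0.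
Proof.
apply: contraPneq => ->; rewrite /cap /= dot0l /enorm dot0l sqrtr0 mulr0.
by rewrite ltxx.
Qed.

Lemma open_cap u : open (cap u).
Proof.
have fc : continuous (fun v : 'rV[R]_a => dot v u - (- (3 / 4)) * enorm v).
  move=> v; have ec : enorm w @[w --> v] --> enorm v by exact: continuous_enorm.
  exact: (cvgB (cvg_dot (@cvg_id _ (nbhs v)) (cvg_cst u))
    (cvgMl_tmp (a := - (3 / 4)) ec)).
rewrite (_ : cap u = (fun v => dot v u - (- (3 / 4)) * enorm v) @^-1` [set x | 0 < x]).
  by apply: open_comp; [move=> v _; exact: fc | exact: open_gt].
by apply/seteqP; split=> v; rewrite /cap /= subr_gt0.
Qed.

Lemma open_capW u : open (cap u `*` W).
Proof.
rewrite (_ : _ `*` _ = (fst @^-1` cap u) `&` (snd @^-1` W)) //.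
apply: openI; apply: open_comp => //.
- by move=> z _; exact: cvg_fst.
- exact: open_cap.
- by move=> z _; exact: cvg_snd.
Qed.

Let seg (u0 : 'rV[R]_a) (t : R) (v : 'rV[R]_a) := (1 - t) *: u0 + t *: nrm v.

Let seg_ge u0 t v : dot u0 u0 = 1 -> 0 <= t <= 1 -> cap u0 v ->
  3^-1 ^+ 2 <= dot (seg u0 t v) (seg u0 t v).
Proof.
move=> u01 /andP[t0 t1] cv; have v0 := cap_neq0 cv.
have : - (3 / 4) < dot (nrm v) u0 by rewrite dot_nrml ltr_pdivlMr ?enorm_gt0.
rewrite /seg; move: (nrm v) (nrm_unit v0) => z z1.
rewrite !(dotDl, dotDr, dotZl, dotZr) u01 z1 (dotC u0).
move: (dot _ _) => d d34.
have h1 : 0 <= t * (1 - t) by rewrite mulr_ge0 // subr_ge0.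
have h2 : 0 <= t * (1 - t) * (d + 3 / 4) by rewrite mulr_ge0 //; lra.
have h3 : 0 <= (t - 1 / 2) ^+ 2 by exact: sqr_ge0.
by nra.
Qed.

Let seg_neq0 u0 t v : dot u0 u0 = 1 -> 0 <= t <= 1 -> cap u0 v -> seg u0 t v != 0.
Proof.
move=> u01 t01 cv; rewrite -dot_gt0; apply: lt_le_trans (seg_ge u01 t01 cv).
by rewrite exprn_gt0 // invr_gt0.
Qed.

(** Normalized segments from the centre spread the constant map to u0 into the
    identity of the cap. Lift this homotopy, starting with sigma0; it keeps the
    centre fixed, so the lift over u0 remains sigma0. *)
Lemma cap_lift u0 (sigma0 : Y -> M) : dot u0 u0 = 1 ->
  lift_on X W (G u0) sigma0 ->
  exists2 sigma, lift_on X (cap u0 `*` W) (fun z => G (nrm z.1) z.2) sigma &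
    forall y, W y -> sigma (u0, y) = sigma0 y.
Proof.
move=> u01 s0P.
pose g t (z : 'rV[R]_a * Y) := G (nrm (seg u0 t z.1)) z.2.
have gL (s t : R) z : 0 <= s <= 1 -> 0 <= t <= 1 -> (cap u0 `*` W) z ->
    `|g s z - g t z| <= (L * 6) * `|s - t|.
  move=> s01 t01 [cz Wz].
  apply: le_trans (GL _ _ Wz) _; [exact/nrm_unit/seg_neq0|exact/nrm_unit/seg_neq0|].
  rewrite -mulrA; apply: ler_wpM2l => //.
  apply: (le_trans (@nrm_lipschitz _ _ 3^-1 _ _ _ _ _)).
  - by rewrite invr_gt0.
  - exact: seg_ge.
  - exact: seg_ge.
  rewrite invrK (_ : seg u0 s z.1 - seg u0 t z.1 = (s - t) *: (nrm z.1 - u0)).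
    rewrite enormZ -mulrA mulrC.
    have n1 : enorm (nrm z.1 - u0) <= 2.
      by apply: enorm_triangle_unit => //; exact/nrm_unit/(cap_neq0 cz).
    by rewrite ler_wpM2r //; lra.
  rewrite /seg; move: (nrm z.1) => w; apply/rowP => i; rewrite !mxE.
  by ring.
have [|||sg sgP sgE] := lift_homotopy M_compact M_hausdorff Xc Xinj Xopen
    (@open_capW u0) _ _ gL (sigma0 := sigma0 \o snd).
- move=> t z t01 [cz Wz].
  pose f (z : 'rV[R]_a * Y) := (seg u0 t z.1, z.2).
  have fc : {for z, continuous f}.
    have z1 : (fun z : 'rV[R]_a * Y => z.1) @ z --> z.1 by exact: cvg_fst.
    have z2 : (fun z : 'rV[R]_a * Y => z.2) @ z --> z.2 by exact: cvg_snd.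
    have nc : nrm v @[v --> z.1] --> nrm z.1.
      exact: (continuous_nrm (cap_neq0 cz)).
    have n1 : (fun z : 'rV[R]_a * Y => nrm z.1) @ z --> nrm z.1.
      exact: (cvg_comp _ _ z1 nc).
    have s1 : (fun z : 'rV[R]_a * Y => seg u0 t z.1) @ z --> seg u0 t z.1.
      exact: (cvgD (cvg_cst _) (cvgZ (cvg_cst t) n1)).
    exact: (cvg_pair s1 z2).
  exact: (continuous_comp fc (Gc (seg_neq0 u01 t01 cz) Wz)).
- by move=> t z t01 [cz Wz]; apply: GT => //; exact/nrm_unit/seg_neq0.
- move=> z [cz Wz] /=; have [sc Xs] := s0P _ Wz; split.
    apply: (@continuous_comp _ _ _ snd sigma0 z); first exact: cvg_snd.
    exact: sc.
  by rewrite /g /seg subr0 scale1r scale0r addr0 (nrm_id u01).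
exists sg.
  move=> z [cz Wz]; have [sc Xs] := sgP z (conj cz Wz); split=> //.
  rewrite Xs /g /seg subrr scale0r add0r scale1r [nrm (nrm _)]nrm_id //.
  exact/nrm_unit/(cap_neq0 cz).
move=> y Wy; apply: (sgE (u0, y)).
  split=> //=; rewrite /cap /= u01 (lt_trans _ (@ltr01 R)) //.
  by rewrite mulNr oppr_lt0 mulr_gt0 // ?enorm_gt0 -?dot_gt0 ?u01 // divr_gt0.
move=> t t01; rewrite /g /seg /= (nrm_id u01) -scalerDl subrK scale1r.
by rewrite subr0 scale1r scale0r addr0.
Qed.

(** By Bessel's inequality <v, u0>^2 + <v, u1>^2 <= |v|^2. *)
Lemma cap_cover u0 u1 v : dot u0 u0 = 1 -> dot u1 u1 = 1 -> dot u1 u0 = 0 ->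
  v != 0 -> cap u0 v \/ cap u1 v.
Proof.
move=> u01 u11 u10 v0; have [h0|h0] := pselect (cap u0 v); first by left.
have [h1|h1] := pselect (cap u1 v); first by right.
exfalso; move: h0 h1; rewrite /cap /= => /negP; rewrite -leNgt => h0.
move=> /negP; rewrite -leNgt => h1.
have := dot_ge0 (v - dot v u0 *: u0 - dot v u1 *: u1).
rewrite !(dotDl, dotNl, dotZl, dotDr, dotNr, dotZr) u01 u11 (dotC u0 u1) u10.
rewrite (dotC u0 v) (dotC u1 v) -(enormK v) !expr2.
have e0 : 0 < enorm v by rewrite enorm_gt0.
have e2 : 0 < enorm v * enorm v by rewrite mulr_gt0.
move: (dot v u0) (dot v u1) (enorm v) h0 h1 e0 e2 => p q e h0 h1 e0 e2 bessel.
have hp : 0 <= (- (3 / 4) * e - p) * (3 / 4 * e - p) by rewrite mulr_ge0 //; lra.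
have hq : 0 <= (- (3 / 4) * e - q) * (3 / 4 * e - q) by rewrite mulr_ge0 //; lra.
by nra.
Qed.

Lemma lift_slice u0 u sigma : dot u u = 1 -> cap u0 u ->
  lift_on X (cap u0 `*` W) (fun z => G (nrm z.1) z.2) sigma ->
  lift_on X W (G u) (fun y => sigma (u, y)).
Proof.
move=> u_unit cu sP y Wy; have [sc Xs] := sP (u, y) (conj cu Wy).
split; last by rewrite Xs /= nrm_id.
apply: (@continuous_comp _ _ _ (fun y => (u, y)) sigma y) => //.
exact: (cvg_pair (cvg_cst u) (@cvg_id _ (nbhs y))).
Qed.

Lemma orthogonal_cap u0 u1 : dot u1 u1 = 1 -> dot u1 u0 = 0 -> cap u0 u1.
Proof.
move=> u11 u10; rewrite /cap /= u10 mulNr oppr_lt0 mulr_gt0 ?divr_gt0 //.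
by rewrite enorm_gt0 -dot_gt0 u11.
Qed.

(** At most two steps, each inside one cap, lead from u0 to any direction. *)
Lemma sphere_reach u0 u (sigma0 : Y -> M) : (1 < a)%N ->
  dot u0 u0 = 1 -> dot u u = 1 -> lift_on X W (G u0) sigma0 ->
  exists sigma, lift_on X W (G u) sigma.
Proof.
move=> a2 u01 u_unit s0P.
have u_neq0 : u != 0 by rewrite -dot_gt0 u_unit.
have [u1 [u11 u10]] := exists_unit_orthogonal1 u0 a2.
have reach v v' sigma : dot v v = 1 -> dot v' v' = 1 -> cap v v' ->
    lift_on X W (G v) sigma -> exists sigma', lift_on X W (G v') sigma'.
  move=> v1 v'1 cvv' sP; have [s' s'P _] := cap_lift v1 sP.
  by exists (fun y => s' (v', y)); exact: lift_slice s'P.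
have [cu|cu] := cap_cover u01 u11 u10 u_neq0; first exact: reach s0P.
have [s1 s1P] := reach _ _ _ u01 u11 (orthogonal_cap u11 u10) s0P.
exact: reach s1P.
Qed.

Lemma dot_le_enorm (v z : 'rV[R]_a) : dot z z = 1 -> dot v z <= enorm v.
Proof.
move=> z1; apply: (le_trans (ler_norm _)).
rewrite -(ler_pXn2r (_ : 0 < 2)%N) ?nnegrE ?sqrtr_ge0 //.
by rewrite real_normK ?num_real // enormK (le_trans (cauchy_schwarz _ _)) // z1 mulr1.
Qed.

Lemma lift_on_segment (D : set ('rV[R]_a * Y)) g sigma tau (p q : 'rV[R]_a) y :
  lift_on X D g sigma -> lift_on X D g tau ->
  (forall t, 0 <= t <= 1 -> D (p + t *: (q - p), y)) ->
  sigma (p, y) = tau (p, y) -> sigma (q, y) = tau (q, y).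
Proof.
move=> sP tP segD.
pose f (t : R) := (p + t *: (q - p), y).
have fc : continuous f.
  move=> t.
  have l1 : (fun t : R => p + t *: (q - p)) @ t --> p + t *: (q - p).
    exact: (cvgD (cvg_cst p) (cvgZr_tmp (@cvg_id _ (nbhs t)))).
  exact: (cvg_pair l1 (cvg_cst y)).
have f0 : f 0 = (p, y) by rewrite /f scale0r addr0.
have f1 : f 1 = (q, y) by rewrite /f scale1r addrC subrK.
have Ac : connected (f @` `[0, 1]).
  apply: connected_continuous_connected; first exact: segment_connected.
  exact: continuous_subspaceT.
apply: (lift_unique M_hausdorff Xinj sP tP Ac).
- by move=> _ [t /= t01 <-]; apply: segD; rewrite in_itv in t01.
- by exists 0 => //=; rewrite in_itv /= lexx ler01.
- by exists 1 => //=; rewrite in_itv /= lexx ler01.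
Qed.

(** A lift over the base direction u0 extends to all directions when the sphere has
    dimension at least 2. Lift over the cap of u0, then over the cap of an
    orthogonal u1, starting there from the first lift. The two agree on the
    intersection of the caps, which is connected: from v move far in a direction z
    orthogonal to u0 and u1, then parallel to the line from v to u1, then back to
    u1. A third orthogonal direction exists because a > 2. *)
Lemma sphere_lift u0 (sigma0 : Y -> M) : (2 < a)%N -> dot u0 u0 = 1 ->
  lift_on X W (G u0) sigma0 ->
  exists sigma : 'rV[R]_a * Y -> M,
    lift_on X ([set v : 'rV[R]_a | v != 0] `*` W) (fun z => G (nrm z.1) z.2) sigma.
Proof.
move=> a3 u01 s0P.
have [u1 [u11 u10]] := exists_unit_orthogonal1 u0 (ltnW a3).
have [z0 [z01]] := exists_unit_orthogonal (col_mx u0 u1) a3.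
rewrite tr_col_mx mul_mx_row !mx11_mul => z0u.
have z0u0 : dot z0 u0 = 0 /\ dot z0 u1 = 0.
  split.
    have := congr1 (fun A => lsubmx A 0 0) z0u.
    by rewrite row_mxKl !mxE /= mulr1n.
  have := congr1 (fun A => rsubmx A 0 0) z0u.
  by rewrite row_mxKr !mxE /= mulr1n.
have cu01 : cap u0 u1 by exact: orthogonal_cap.
have [sA sAP sAE] := cap_lift u01 s0P.
have s1P := lift_slice u11 cu01 sAP.
have [sB sBP sBE] := cap_lift u11 s1P.
have agree v y : cap u0 v -> cap u1 v -> W y -> sA (v, y) = sB (v, y).
  move=> c0 c1 Wy.
  pose D := (cap u0 `&` cap u1) `*` W.
  have sAD : lift_on X D (fun z => G (nrm z.1) z.2) sA.
    by move=> z [[h0 h1] Wz]; exact: sAP.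
  have sBD : lift_on X D (fun z => G (nrm z.1) z.2) sB.
    by move=> z [[h0 h1] Wz]; exact: sBP.
  have start : sA (u1, y) = sB (u1, y) by rewrite sBE.
  have [z [z1 zu0 zu1 vz]] : exists z, [/\ dot z z = 1, dot z u0 = 0, dot z u1 = 0 & 0 <= dot v z].
    case: z0u0 => h0 h1; have [vz|vz] := leP 0 (dot v z0); first by exists z0.
    exists (- z0); rewrite !(dotNl, dotNr) opprK h0 h1 !oppr0 z01.
    by split=> //; rewrite oppr_ge0 ltW.
  (* Far enough in the direction z, bounded components along u0 and u1 do not
     lead out of the caps. *)
  pose S := 2 * (`|dot v u0| + `|dot v u1|) + 1.
  have n0 : 0 <= `|dot v u0| by []. have n1 : 0 <= `|dot v u1| by [].
  have S0 : 0 < S by rewrite /S; lra.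
  have v0 : - `|dot v u0| <= dot v u0 by rewrite lerNl -normrN ler_norm.
  have v1 : - `|dot v u1| <= dot v u1 by rewrite lerNl -normrN ler_norm.
  have uu1 : dot u1 z = 0 by rewrite dotC.
  have start2 : sA (u1 + S *: z, y) = sB (u1 + S *: z, y).
    apply: (lift_on_segment sAD sBD _ start) => t /andP[t0 t1].
    rewrite addrAC subrr add0r scalerA; split=> //.
    have w0 : 0 < enorm (u1 + (t * S) *: z).
      rewrite enorm_gt0; apply/eqP => /(congr1 (dot ^~ u1)) /eqP.
      by rewrite dotDl dotZl u11 zu1 mulr0 addr0 dot0l oner_eq0.
    split; rewrite /cap /= dotDl dotZl ?u10 ?zu0 ?u11 ?zu1 mulr0; lra.
  have start3 : sA (v + S *: z, y) = sB (v + S *: z, y).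
    apply: (lift_on_segment sAD sBD _ start2) => t /andP[t0 t1].
    have -> : v + S *: z - (u1 + S *: z) = v - u1.
      by rewrite opprD addrACA subrr addr0.
    split=> //; set w := u1 + _ + _.
    have wz : S <= enorm w.
      apply: le_trans (dot_le_enorm w z1).
      rewrite /w !(dotDl, dotNl, dotZl) uu1 z1 oppr0 addr0 add0r mulr1 lerDl.
      by rewrite mulr_ge0.
    have w0 : dot w u0 = t * dot v u0.
      by rewrite /w !(dotDl, dotNl, dotZl) u10 zu0; ring.
    have w1 : dot w u1 = (1 - t) + t * dot v u1.
      by rewrite /w !(dotDl, dotNl, dotZl) u11 zu1; ring.
    have t0' : 0 <= t * (dot v u0 + `|dot v u0|) by rewrite mulr_ge0 //; lra.
    have t1' : 0 <= t * (dot v u1 + `|dot v u1|) by rewrite mulr_ge0 //; lra.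
    have t2 : 0 <= (1 - t) * `|dot v u0| by rewrite mulr_ge0 //; lra.
    have t3 : 0 <= (1 - t) * `|dot v u1| by rewrite mulr_ge0 //; lra.
    by split; rewrite /cap /= ?w0 ?w1; move: wz; rewrite /S => wz; lra.
  apply: (lift_on_segment sAD sBD _ start3) => t /andP[t0 t1].
  have -> : v + S *: z + t *: (v - (v + S *: z)) = v + (S * (1 - t)) *: z.
    apply/rowP => i; rewrite !mxE; ring.
  set s := S * (1 - t); have s0 : 0 <= s by rewrite mulr_ge0 ?subr_ge0 // ltW.
  have vw : enorm v <= enorm (v + s *: z).
    rewrite -(ler_pXn2r (_ : 0 < 2)%N) ?nnegrE ?sqrtr_ge0 // !enormK.
    rewrite !(dotDl, dotDr, dotZl, dotZr) (dotC z v) z1.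
    have h1 : 0 <= s * dot v z by rewrite mulr_ge0.
    have h2 : 0 <= s * s by rewrite mulr_ge0.
    by lra.
  move: c0 c1; rewrite /cap /= => c0 c1.
  by split=> //; split; rewrite /cap /= dotDl dotZl ?zu0 ?zu1; lra.
have cover v : v != 0 -> cap u0 v \/ cap u1 v by exact: cap_cover.
pose s z := if pselect (cap u0 z.1) is left _ then sA z else sB z.
have sE0 z : cap u0 z.1 -> s z = sA z by rewrite /s; case: pselect.
have sE1 z : cap u1 z.1 -> W z.2 -> s z = sB z.
  by rewrite /s; case: pselect => // h0 h1 Wz; case: z h0 h1 Wz => /= v y; exact: agree.
have near_lift z (u : 'rV[R]_a) tau : lift_on X (cap u `*` W) (fun z => G (nrm z.1) z.2) tau ->
    (forall z', (cap u `*` W) z' -> s z' = tau z') -> (cap u `*` W) z ->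
    {for z, continuous s} /\ X (s z) = G (nrm z.1) z.2.
  move=> tP sE Dz; have [tc Xt] := tP z Dz; rewrite sE //; split=> //.
  have nz : \forall z' \near z, s z' = tau z'.
    have : \forall z' \near z, (cap u `*` W) z'.
      by have := @open_capW u; rewrite openE => /(_ z Dz).
    by apply: filterS => z'; exact: sE.
  move=> V; rewrite sE // => /tc nV.
  by apply: filterS2 nz nV => z' /= + h; rewrite /= => ->.
exists s => z [/= z10 Wz]; case: (cover _ z10) => cz.
- by apply: (near_lift _ u0 sA) => //; move=> z' [h _]; exact: sE0.
- by apply: (near_lift _ u1 sB) => //; move=> z' [h h']; exact: sE1.
Qed.

End SphereLift.
(** * The immersion is a local homeomorphism to the product of spheres *)

Section NearPositive.
Context {R : realType}.

Lemma coef_le_norm m n (A : 'M[R]_(m, n)) i j : `|A i j| <= `|A|.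
Proof.
rewrite [leRHS]/Num.Def.normr /= mx_normrE.
exact: (@le_bigmax _ _ _ 0 (fun ij => `|A ij.1 ij.2|) (i, j)).
Qed.

Lemma coord_le_enorm n (v : 'rV[R]_n) i : `|v 0 i| <= enorm v.
Proof. exact: le_trans (coef_le_norm _ _ _) (norm_le_enorm v). Qed.

Lemma dot_mulmx_bound n (K : 'M[R]_n) (z : 'rV[R]_n) :
  `|dot (z *m K) z| <= n%:R * n%:R * `|K| * dot z z.
Proof.
have term i j : `|z 0 i * K i j * z 0 j| <= `|K| * dot z z.
  rewrite !normrM mulrAC mulrC -(enormK z) expr2.
  by apply: ler_pM; rewrite ?mulr_ge0 ?coef_le_norm // ler_pM ?coord_le_enorm.
rewrite /dot (le_trans (ler_norm_sum _ _ _)) //.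
apply: (@le_trans _ _ (\sum_(j < n) \sum_(i < n) `|K| * dot z z)).
  apply: ler_sum => j _; rewrite mxE mulr_suml (le_trans (ler_norm_sum _ _ _)) //.
  by apply: ler_sum => i _; exact: term.
by rewrite !sumr_const !card_ord -mulrnA -[_ *+ (n * n)]mulr_natl natrM mulrA.
Qed.

(** Positivity of a symmetric matrix is an open condition: after a change of basis
    m u0 is the identity and m u is close to it. *)
Lemma posdef_near n (u0 : 'rV[R]_n) (m : 'rV[R]_n -> 'M[R]_n) :
  m @ u0 --> m u0 -> (m u0)^T = m u0 ->
  (forall xi : 'rV[R]_n, xi != 0 -> 0 < dot (xi *m m u0) xi) ->
  \forall u \near u0, forall xi : 'rV[R]_n, xi != 0 -> 0 < dot (xi *m m u) xi.
Proof.
move=> mc msym mpos; have [Q QE] := posdef_orthonormalize msym mpos.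
have Qu : Q \in unitmx by have [] := mulmx1_unit QE; rewrite unitmx_mul => /andP[].
have Dc : (fun u => Q *m m u *m Q^T) @ u0 --> (1%:M : 'M[R]_n).
  rewrite -QE; exact: (cvg_mulmx (cvg_mulmx (cvg_cst Q) mc) (cvg_cst Q^T)).
pose e := (n%:R * n%:R + 1 : R)^-1.
have nn0 : 0 <= n%:R * n%:R :> R by rewrite mulr_ge0 ?ler0n.
have e0 : 0 < e by rewrite invr_gt0 ltr_wpDl.
move/cvgrPdist_lt: Dc => /(_ _ e0); apply: filterS => u ue xi xi0.
pose z := xi *m invmx Q.
have xiE : xi = z *m Q by rewrite mulmxKV.
have z0 : z != 0 by apply: contra_neq xi0 => z0; rewrite xiE z0 mul0mx.
have -> : dot (xi *m m u) xi = dot (z *m (Q *m m u *m Q^T)) z.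
  by rewrite {1 2}xiE [RHS]dotC !mulmxA [RHS]dotC [in RHS]dot_mulmxl trmxK.
set D := Q *m m u *m Q^T in ue *.
have -> : D = 1%:M - (1%:M - D) by rewrite subKr.
rewrite mulmxBr mulmx1 dotBl subr_gt0; apply: (le_lt_trans (ler_norm _)).
apply: (le_lt_trans (dot_mulmx_bound _ _)).
have zz : 0 < dot z z by rewrite dot_gt0.
rewrite -[ltRHS]mul1r ltr_pM2r //.
have ee : (n%:R * n%:R + 1) * e = 1 by rewrite divff // gt_eqF // ltr_wpDl.
apply: (@le_lt_trans _ _ (n%:R * n%:R * e)).
  by rewrite ler_wpM2l // ltW.
by rewrite -[ltRHS]ee ltr_pM2r // ltrDl.
Qed.

Lemma first_derivative_test n (w : 'rV[R]_n -> R) (g z : 'rV[R]_n)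
    (dw : 'rV[R]_n -> 'rV[R]_n) :
  (\forall u \near z, forall xi, is_derive u xi w (dot xi (dw u))) ->
  (\forall u \near z, w z <= w u) -> dw z = 0.
Proof.
move=> wd zmin.
have test xi : dot xi (dw z) = 0.
  have [e /= e0 eP] : \forall t \near (0 : R),
      (forall xi', is_derive (z + t *: xi) xi' w (dot xi' (dw (z + t *: xi)))) /\
      w z <= w (z + t *: xi).
    apply: filterI; first exact: (@cvg_line _ _ z xi _ wd).
    exact: (@cvg_line _ _ z xi _ zmin).
  have inP (t : R) : t \in `](- e), e[%R -> ball_ Num.norm 0 e t.
    by rewrite in_itv /= sub0r normrN ltr_norml.
  have lined (t : R) : t \in `](- e), e[%R ->
      is_derive t (1 : R) (fun t => w (z + t *: xi)) (dot xi (dw (z + t *: xi))).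
    by move=> /inP /eP [wd' _]; exact: is_derive_line (wd' xi).
  have in0 : 0 \in `](- e), e[%R by rewrite in_itv /= oppr_lt0 e0.
  have [|||_ dE] := @derive1_at_min _ (fun t : R => w (z + t *: xi)) (- e) e 0 _ _ in0.
  - by rewrite ge0_cp // ltW.
  - by move=> t /lined [].
  - by move=> t /inP /eP [_]; rewrite scale0r addr0.
  by move: dE; have [_ ->] := lined _ in0; rewrite scale0r addr0.
by apply/eqP; rewrite -dot_eq0 test.
Qed.

End NearPositive.
Section SphereMap.
Context {R : realType} {n a b : nat} (ab : (a + b = n.+2)%N).
Context {M : topologicalType} (A : smooth_atlas R n M).
Variables (rho r : R) (rho0 : 0 < rho) (r0 : 0 < r).
Variables X N : M -> 'rV[R]_a * 'rV[R]_b.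
Hypothesis hX : immersion_in_cylinder A rho X.
Hypothesis hN : unit_normal_field A X N.
Hypothesis x_sphere : forall p, dot (X p).1 (X p).1 = r ^+ 2.

Let y_sphere p : dot (X p).2 (X p).2 = rho ^+ 2.
Proof. by have [_ /(_ p) [_ <-] _] := hX; rewrite enormK. Qed.

Definition sphere_product : set ('rV[R]_a * 'rV[R]_b) :=
  [set q | dot q.1 q.1 = r ^+ 2 /\ dot q.2 q.2 = rho ^+ 2].

Lemma defect_grad_eq0 c u : charts A c -> dom c u -> defect_grad X c u = 0.
Proof.
move=> hc cu; apply/rowP => i; rewrite !mxE.
have := is_derive_fst (is_derive_chart hX hc (delta_mx 0 i) cu).
rewrite sum_delta_tang => dd; have [_] := is_derive_dot dd dd.
rewrite (_ : (fun x => _) = cst (r ^+ 2)); last first.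
  by apply/funext => v; exact: x_sphere.
rewrite derive_cst dotC => /esym /eqP; rewrite -mulr2n mulrn_eq0 /= => /eqP ->.
by rewrite oppr0.
Qed.

(** Since |x| is constant, x is normal and N is a multiple of (x, 0); so the normal
    vectors at a point are spanned by (x, 0) and (0, y). *)
Lemma normal_space c u (v : 'rV[R]_(a + b)) : charts A c -> dom c u ->
  v *m (jac X c u)^T = 0 ->
  exists l m, v = row_mx (l *: (X (param c u)).1) (m *: (X (param c u)).2).
Proof.
move=> hc cu vJ; set p := param c u.
have [x1 x2] := normal_position ab rho0 hX hN hc cu (defect_grad_eq0 hc cu).
rewrite -/p in x1 x2; set s := dot _ _ in x1 x2.
have s0 : s != 0.
  apply/eqP => s0; have := x_sphere p; rewrite x1 s0 scale0r dot0l => /esym /eqP.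
  by rewrite expf_eq0 /= gt_eqF.
have N2 : (N p).2 = 0 by apply/eqP; move/eqP: x2; rewrite scaler_eq0 (negPf s0).
have N1 : (N p).1 = s^-1 *: (X p).1 by rewrite x1 scalerA mulVf // scale1r.
have := completeness ab rho0 hX hN hc cu.
move=> /(congr1 (mulmx v)); rewrite mulmx1 !mulmxDr !(mulmxA v) vJ !mul0mx add0r.
rewrite !mx11_mul !mul_scalar_mx => <-.
rewrite /flat /rad -/p N2 N1 !scale_row_mx add_row_mx !scaler0 addr0 add0r !scalerA.
by eexists; eexists; congr row_mx.
Qed.

(** Near u0 the Jacobians J u satisfy xi (J u) (J u0)^T xi^T > 0 for xi != 0. If X took
    the same value at u' and u' + xi, the mean value theorem for the component of
    X along xi (J u0) would contradict this. *)
Lemma locally_injective (p : M) : exists2 V : set M, nbhs p V &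
  forall q q', V q -> V q' -> X q = X q' -> q = q'.
Proof.
have [c hc cp] := charts_cover A p; have cu := coord_dom cp.
set u0 := Defs.coord c p in cu.
pose m u := jac X c u *m (jac X c u0)^T.
have mc : m @ u0 --> m u0.
  exact: (cvg_mulmx (cvg_jac hX hc cu) (cvg_cst _)).
have msym : (m u0)^T = m u0 by rewrite /m trmx_mul trmxK.
have mpos := posdef_near mc msym (gram_posdef (jac_inj hX hc cu)).
have /nbhs_ballP[e /= e0 eP] : \forall u \near u0, dom c u /\
    forall xi : 'rV[R]_n, xi != 0 -> 0 < dot (xi *m m u) xi.
  by apply: filterI; [exact: (dom_open cu) | exact: mpos].
exists (cod c `&` Defs.coord c @^-1` ball u0 e).
  apply: filterI; first by have := cod_open c; rewrite openE => /(_ _ cp).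
  apply: (Defs.coord_continuous cp); exact: nbhsx_ballx.
move=> q q' [cq bq] [cq' bq'] Xqq'.
rewrite -(coordK cq) -(coordK cq'); congr (param c _).
set u := Defs.coord c q in bq *; set u' := Defs.coord c q' in bq' *.
apply/eqP; rewrite -subr_eq0; apply: contrapT => /negP xi0.
pose xi := u - u'; pose l t := u' + t *: xi.
have lball t : 0 <= t <= 1 -> ball u0 e (l t).
  move=> /andP[t0 t1]; move: bq bq'; rewrite -!ball_normE /ball_ /= => h h'.
  have -> : u0 - l t = (1 - t) *: (u0 - u') + t *: (u0 - u).
    by apply/rowP => i; rewrite !mxE; ring.
  apply: (le_lt_trans (ler_normD _ _)); rewrite !normrZ !ger0_norm ?subr_ge0 //.
  have [->|tn0] := eqVneq t 0; first by rewrite subr0 mul1r mul0r addr0.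
  have tp : 0 < t by rewrite lt_neqAle eq_sym tn0.
  have h1 : (1 - t) * `|u0 - u'| <= (1 - t) * e by rewrite ler_wpM2l ?subr_ge0 // ltW.
  have h2 : t * `|u0 - u| < t * e by rewrite ltr_pM2l.
  by apply: (lt_le_trans (ler_ltD h1 h2)); rewrite -mulrDl subrK mul1r.
pose eta := xi *m jac X c u0.
pose phi t := dot (flat (X (param c (l t)))) eta.
have phid (t : R) : 0 <= t <= 1 -> is_derive t (1 : R) phi (dot (xi *m m (l t)) xi).
  move=> t01; have [clt _] := eP _ (lball t t01).
  have fd := is_derive_flat (is_derive_chart hX hc xi clt).
  rewrite -mul_jac in fd.
  have := is_derive_line (is_derive_dot fd (is_derive_cst eta (l t) xi)).
  move=> /is_derive_eq; apply; rewrite dot0r addr0 /eta.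
  by rewrite /m mulmxA [RHS]dot_mulmxl trmxK.
have [||t] := @MVT R phi (fun t => dot (xi *m m (l t)) xi) 0 1 ltr01.
- move=> t; rewrite in_itv /= => /andP[t0 t1]; apply: phid.
  by rewrite !ltW.
- apply: derivable_within_continuous => t; rewrite in_itv /= => t01.
  by have [] := phid t t01.
rewrite in_itv /= => /andP[t0 t1]; rewrite subr0 mulr1.
have l1 : l 1 = u by rewrite /l scale1r addrC subrK.
have l0 : l 0 = u' by rewrite /l scale0r addr0.
rewrite /phi l1 l0.
rewrite (coordK cq) (coordK cq') Xqq' subrr => E0.
have t01 : 0 <= t <= 1 by rewrite !ltW.
have [_ pos] := eP _ (lball t t01).
by have := pos _ xi0; rewrite -/xi -E0 ltxx.
Qed.

(** A point q of the sphere on the line through 0 and x is x or - x, and - x is too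
    far away. *)
Lemma on_sphere_multiple k (x q z : 'rV[R]_k) (s l : R) : 0 < s ->
  dot x x = s ^+ 2 -> dot q q = s ^+ 2 -> x - q = z -> z = l *: x ->
  dot z z < s ^+ 2 -> q = x.
Proof.
move=> s0 xx qq zE zl zs.
have qE : q = (1 - l) *: x by rewrite scalerBl scale1r -zl -zE subKr.
have s2 : s ^+ 2 != 0 by rewrite expf_neq0 // gt_eqF.
have : (1 - l) ^+ 2 = 1.
  by apply: (mulIf s2); rewrite mul1r -{1}xx -qq qE dotZl dotZr expr2; ring.
move=> /eqP; rewrite sqrf_eq1 => /orP[]/eqP l1.
  by rewrite qE l1 scale1r.
exfalso; move: zs; rewrite zl dotZl dotZr xx (_ : l = 2); last by lra.
rewrite mulrA gtr_pMl ?exprn_gt0 //; lra.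
Qed.

(** In place of an inverse function theorem: given q near X p, minimize the distance
    from q to X over a closed cube around p. By local injectivity the minimum is
    attained in the interior, where the difference to q is normal; as q lies on the
    product of spheres and is close, the difference is 0. *)
Lemma locally_open (p : M) (V : set M) : nbhs p V -> exists2 d : R, 0 < d &
  forall q, sphere_product q -> `|q - X p| < d -> exists2 p', V p' & X p' = q.
Proof.
move=> nV; have [c hc cp] := charts_cover A p; have cu := coord_dom cp.
set u0 := Defs.coord c p in cu; have pE : param c u0 = p by exact: coordK.
have [V' nV' Vinj] := locally_injective p.
have pc : param c @ u0 --> p by rewrite -pE; exact: (param_continuous cu).
have /nbhs_ballP[e /= e0 eP] : \forall u \near u0,
    [/\ dom c u, V (param c u) & V' (param c u)].
  near=> u; split; near: u; [exact: (dom_open cu)|exact: (pc _ nV)|exact: (pc _ nV')].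
pose s := e / 2; have s0 : 0 < s by rewrite divr_gt0.
pose K := [set u : 'rV[R]_n | `|u0 - u| <= s].
have KP u : K u -> [/\ dom c u, V (param c u) & V' (param c u)].
  move=> zu; apply: eP; rewrite -ball_normE /ball_ /= (le_lt_trans zu) //.
  by rewrite ltr_pdivrMr // ltr_pMr // ltr1n.
have Kc : compact K by exact: closed_ball_compact.
have Fc u : dom c u -> (fun u => flat (X (param c u))) @ u --> flat (X (param c u)).
  move=> cv; have h := Cinfty_continuous (chart_smooth hX hc) cv.
  exact: (cvg_flat h).
pose dist (z : 'rV[R]_(a + b)) u :=
  dot (flat (X (param c u)) - z) (flat (X (param c u)) - z).
have distc z u : dom c u -> {for u, continuous (dist z)}.
  move=> cv; pose proof (cvgB (Fc u cv) (cvg_cst z)) as fz.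
  exact: (cvg_dot fz fz).
pose S := K `&` (fun u : 'rV[R]_n => `|u0 - u|) @^-1` [set s].
have Sc : compact S.
  apply: (closed_subset_compact Kc); last by move=> u [].
  apply: closed_preimage_within; first exact: closed_closed_ball_.
    exact: closed_eq.
  by move=> u _; exact: continuous_dist.
have Kp : K u0 by rewrite /K /= subrr normr0 ltW.
have [k0 [k0p k0P]] : exists k0, 0 < k0 /\ forall u, S u -> k0 <= dist (flat (X p)) u.
  have [[u1 Su1]|S0] := pselect (S !=set0); last first.
    by exists 1; split=> // u Su; exfalso; apply: S0; exists u.
  have [|v [Kv vs] vP] := compact_argmin (ex_intro _ u1 Su1) Sc (f := dist (flat (X p))).
    by move=> u [/KP[cv _ _] _]; exact: distc.
  exists (dist (flat (X p)) v); split=> //.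
  have [cv _ V'v] := KP v Kv; have [_ _ V'p] := KP u0 Kp.
  rewrite /dist dot_gt0 subr_eq0; apply/eqP => E0.
  have XE : X (param c v) = X (param c u0).
    move: E0; rewrite pE /flat; case: (X _) (X _) => v1 v2 [w1 w2] /=.
    by move=> /eq_row_mx [-> ->].
  have vu : v = u0.
    by rewrite -(paramK cv) -(paramK cu) (Vinj _ _ V'v V'p XE).
  by move: vs; rewrite /= vu subrr normr0 => /eqP; rewrite lt_eqF.
(* The bound k0 / 4 puts the minimum in the interior, the bounds r ^+ 2 and
   rho ^+ 2 exclude that q is antipodal to the nearest point in a factor. *)
pose k := Num.min (k0 / 4) (Num.min (r ^+ 2) (rho ^+ 2)).
have kp : 0 < k by rewrite !lt_min divr_gt0 ?exprn_gt0.
have [k4 kr krho] : [/\ k <= k0 / 4, k <= r ^+ 2 & k <= rho ^+ 2].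
  by rewrite /k !ge_min !lexx !orbT.
have /nbhs_ballP[d /= d0 dP] : \forall q \near X p,
    dot (flat q - flat (X p)) (flat q - flat (X p)) < k.
  have fz : (fun q : 'rV[R]_a * 'rV[R]_b => flat q - flat (X p)) @ X p
      --> flat (X p) - flat (X p).
    exact: (cvgB (cvg_flat (@cvg_id _ (nbhs (X p)))) (cvg_cst (flat (X p)))).
  pose proof (cvg_dot fz fz) as dz; rewrite subrr dot0l in dz.
  exact: (cvgr_lt _ dz).
exists d => // q [q1 q2] qd; set z := flat q.
have qk : dot (z - flat (X p)) (z - flat (X p)) < k.
  by apply: dP; rewrite -ball_normE /ball_ /= distrC.
have [|m Km mP] := compact_argmin (ex_intro _ u0 Kp) Kc (f := dist z).
  by move=> u /KP[cv _ _]; exact: distc.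
have du0 : dist z u0 < k.
  by rewrite /dist pE -opprB dotNl dotNr opprK.
have dm : dist z m < k by exact: le_lt_trans (mP _ Kp) du0.
have [cm Vm _] := KP m Km.
have ms : `|u0 - m| < s.
  rewrite lt_neqAle Km andbT; apply/eqP => ms.
  have := k0P m (conj Km ms); move: dm qk; rewrite /dist.
  rewrite -[flat (X (param c m)) - flat (X p)](subrKA z).
  move: (flat (X (param c m)) - z) (z - flat (X p)) => v w vk wk.
  have := dot_ge0 (v - w); rewrite !(dotDl, dotDr, dotNl, dotNr) (dotC w v).
  by lra.
have nearK : \forall u \near m, K u.
  have : \forall u \near m, `|u0 - u| < s.
    by move: (@continuous_dist R 'rV[R]_n u0 m) => /cvgr_lt /(_ _ ms).
  by apply: filterS => u; exact: ltW.
have grad0 : 2 *: ((flat (X (param c m)) - z) *m (jac X c m)^T) = 0.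
  apply: (@first_derivative_test R n (dist z) 0 m
    (fun u => 2 *: ((flat (X (param c u)) - z) *m (jac X c u)^T))).
    apply: filterS nearK => u /KP[cv _ _] xi.
    have fd := is_derive_flat (is_derive_chart hX hc xi cv).
    rewrite -mul_jac in fd.
    have gd := is_deriveB fd (is_derive_cst z u xi).
    apply: is_derive_eq (is_derive_dot gd gd) _.
    by rewrite subr0 dotZr -dot_mulmxl [X in _ + X = _]dotC mulr_natl mulr2n.
  by apply: filterS nearK => u Ku; exact: mP.
have [|l [l' zE]] := @normal_space c m (flat (X (param c m)) - z) hc cm.
  by apply/eqP; move/eqP: grad0; rewrite scaler_eq0 pnatr_eq0.
have zE' : row_mx ((X (param c m)).1 - q.1) ((X (param c m)).2 - q.2)
    = row_mx (l *: (X (param c m)).1) (l' *: (X (param c m)).2).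
  by rewrite -zE /z /flat opp_row_mx add_row_mx.
have [e1 e2] := eq_row_mx zE'.
have dE : dist z m = dot ((X (param c m)).1 - q.1) ((X (param c m)).1 - q.1)
    + dot ((X (param c m)).2 - q.2) ((X (param c m)).2 - q.2).
  by rewrite /dist /z /flat opp_row_mx add_row_mx dot_row_mx.
have g1 := dot_ge0 ((X (param c m)).1 - q.1).
have g2 := dot_ge0 ((X (param c m)).2 - q.2).
exists (param c m) => //.
have E1 : q.1 = (X (param c m)).1.
  by apply: (on_sphere_multiple r0 (x_sphere _) q1 (erefl _) e1); lra.
have E2 : q.2 = (X (param c m)).2.
  by apply: (on_sphere_multiple rho0 (y_sphere _) q2 (erefl _) e2); lra.
by case: (X _) E1 E2 => x y /= <- <-; case: (q).
Unshelve. all: by end_near. Qed.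

End SphereMap.
(** * Range and injectivity *)

Section SphereProduct.
Context {R : realType} {a b : nat} {M : topologicalType}.
Variables (r rho : R) (r0 : 0 < r) (rho0 : 0 < rho).
Local Notation E := ('rV[R]_a * 'rV[R]_b)%type.
Local Notation T := (@sphere_product R a b rho r).
Variable X : M -> E.
Hypothesis M_compact : compact [set: M].
Hypothesis M_hausdorff : hausdorff_space M.
Hypothesis Xc : continuous X.
Hypothesis XT : forall p, T (X p).
Hypothesis Xinj : forall p : M, exists2 V : set M, nbhs p V &
  forall q q', V q -> V q' -> X q = X q' -> q = q'.
Hypothesis Xopen : forall (p : M) (V : set M), nbhs p V ->
  exists2 d : R, 0 < d &
  forall q, T q -> `|q - X p| < d -> exists2 p', V p' & X p' = q.

Let move1 (u : 'rV[R]_a) (y : 'rV[R]_b) : E := (r *: u, rho *: nrm y).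
Let move2 (x : 'rV[R]_a) (u : 'rV[R]_b) (y : R) : E := (x, rho *: u).

Let W1 : set 'rV[R]_b := [set y | y != 0].

Lemma open_neq0 m : open [set v : 'rV[R]_m | v != 0].
Proof.
rewrite (_ : [set v | _] = (@enorm R m) @^-1` [set x | 0 < x]).
  by apply: open_comp; [move=> v _; exact: continuous_enorm | exact: open_gt].
by apply/seteqP; split=> v /=; rewrite enorm_gt0.
Qed.

Let T1 u y : dot u u = 1 -> W1 y -> T (move1 u y).
Proof.
move=> u1 y0; split; rewrite /= dotZl dotZr ?u1 ?nrm_unit // mulr1 expr2 //.
Qed.

Let T2 x u y : dot x x = r ^+ 2 -> dot u u = 1 -> [set: R] y -> T (move2 x u y).
Proof. by move=> xr u1 _; split; rewrite //= dotZl dotZr u1 mulr1 expr2. Qed.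

Let norm_pairl (v : 'rV[R]_a) : `|(v, 0) : E| = `|v|.
Proof. by rewrite prod_normE /= normr0 maxC max_r. Qed.

Let norm_pairr (v : 'rV[R]_b) : `|(0, v) : E| = `|v|.
Proof. by rewrite prod_normE /= normr0 max_r. Qed.

Let L1 u u' y : dot u u = 1 -> dot u' u' = 1 -> W1 y ->
  `|move1 u y - move1 u' y| <= r * enorm (u - u').
Proof.
move=> _ _ _; have -> : move1 u y - move1 u' y = (r *: (u - u'), 0).
  by rewrite scalerBr -[in RHS](subrr (rho *: nrm y)).
by rewrite norm_pairl normrZ gtr0_norm // ler_pM2l // norm_le_enorm.
Qed.

Let L2 x u u' y : dot u u = 1 -> dot u' u' = 1 -> [set: R] y ->
  `|move2 x u y - move2 x u' y| <= rho * enorm (u - u').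
Proof.
move=> _ _ _; have -> : move2 x u y - move2 x u' y = (0, rho *: (u - u')).
  by rewrite scalerBr -[in RHS](subrr x).
by rewrite norm_pairr normrZ gtr0_norm // ler_pM2l // norm_le_enorm.
Qed.

Let C1 (v : 'rV[R]_a) y : v != 0 -> W1 y ->
  {for (v, y), continuous (fun z : 'rV[R]_a * 'rV[R]_b => move1 (nrm z.1) z.2)}.
Proof.
move=> v0 y0.
have z1 : (fun z : 'rV[R]_a * 'rV[R]_b => z.1) @ (v, y) --> v by exact: cvg_fst.
have z2 : (fun z : 'rV[R]_a * 'rV[R]_b => z.2) @ (v, y) --> y by exact: cvg_snd.
have n1 : nrm w @[w --> v] --> nrm v by exact: continuous_nrm.
have n2 : nrm w @[w --> y] --> nrm y by exact: continuous_nrm.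
exact: (cvg_pair (cvgZ (cvg_cst r) (cvg_comp _ _ z1 n1))
                 (cvgZ (cvg_cst rho) (cvg_comp _ _ z2 n2))).
Qed.

Let C2 x (v : 'rV[R]_b) y : v != 0 -> [set: R] y ->
  {for (v, y), continuous (fun z : 'rV[R]_b * R => move2 x (nrm z.1) z.2)}.
Proof.
move=> v0 _.
have z1 : (fun z : 'rV[R]_b * R => z.1) @ (v, y) --> v by exact: cvg_fst.
have n1 : nrm w @[w --> v] --> nrm v by exact: continuous_nrm.
exact: (cvg_pair (cvg_cst x) (cvgZ (cvg_cst rho) (cvg_comp _ _ z1 n1))).
Qed.

Let nrm_onto k (s : R) (v : 'rV[R]_k) : 0 < s -> dot v v = s ^+ 2 ->
  s *: nrm v = v /\ dot (nrm v) (nrm v) = 1.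
Proof.
move=> s0 vs; split; first exact: scale_nrm.
by apply: nrm_unit; rewrite -dot_gt0 vs exprn_gt0.
Qed.

Let neq0_sphere k (s : R) (v : 'rV[R]_k) : 0 < s -> dot v v = s ^+ 2 -> v != 0.
Proof. by move=> s0 vs; rewrite -dot_gt0 vs exprn_gt0. Qed.

Let const_lift p : lift_on X [set: R] (move2 (X p).1 (nrm (X p).2)) (fun _ => p).
Proof.
move=> t _; split; first exact: cst_continuous.
have [_ Xp2] := XT p; rewrite /move2 (nrm_onto rho0 Xp2).1.
by case: (X p).
Qed.

Lemma second_factor_lift : (2 < b)%N -> forall p,
  exists tau, lift_on X W1 (move1 (nrm (X p).1)) tau.
Proof.
move=> b3 p; have [x0r y0r] := XT p.
have [rx ux] := nrm_onto r0 x0r; have [_ uy] := nrm_onto rho0 y0r.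
have [s sP] := sphere_lift M_compact M_hausdorff Xc Xinj Xopen openT
  (ltW rho0) (fun u t => T2 x0r) (@L2 (X p).1) (@C2 (X p).1) b3 uy
  (@const_lift p).
exists (fun y => s (y, 0)) => y y0; have [sc Xs] := sP (y, 0) (conj y0 I).
split; last by rewrite Xs /move1 /move2 rx.
apply: (@continuous_comp _ _ _ (fun y => (y, 0 : R)) s y) => //.
exact: (cvg_pair (@cvg_id _ (nbhs y)) (cvg_cst (0 : R))).
Qed.

(** Lift the whole second sphere at the first factor of some X p0, then move the
    first factor to any prescribed direction. *)
Lemma sphere_product_range : (1 < a)%N -> (2 < b)%N -> M -> range X = T.
Proof.
move=> a2 b3 p0; apply/seteqP; split=> [_ [p _ <-]|[x y] [/= xr yr]].
  exact: XT.
have [x0r _] := XT p0; have [tau tauP] := second_factor_lift b3 p0.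
have [rx ux] := nrm_onto r0 xr; have [ry uy] := nrm_onto rho0 yr.
have [_ ux0] := nrm_onto r0 x0r.
have [s sP] := sphere_reach M_compact M_hausdorff Xc Xinj Xopen
  (@open_neq0 b) (ltW r0) T1 L1 C1 a2 ux0 ux tauP.
have [_ Xs] := sP y (neq0_sphere rho0 yr).
by exists (s y) => //; rewrite Xs /move1 rx ry.
Qed.

(** Both spheres are simply connected, so X has a continuous section s through p0.
    The maps s o X and the identity are lifts of X to itself that agree at one
    point of the connected space M. *)
Lemma sphere_product_injective : connected [set: M] -> (2 < a)%N -> (2 < b)%N ->
  injective X.
Proof.
move=> M_connected a3 b3 p0 p0'.
have [x0r y0r] := XT p0; have [tau tauP] := second_factor_lift b3 p0.
have [rx ux] := nrm_onto r0 x0r; have [ry uy] := nrm_onto rho0 y0r.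
have [s sP] := sphere_lift M_compact M_hausdorff Xc Xinj Xopen
  (@open_neq0 b) (ltW r0) T1 L1 C1 a3 ux tauP.
have sX p : X (s (X p)) = X p.
  have [xr yr] := XT p.
  have [_ ->] := sP (X p) (conj (neq0_sphere r0 xr) (neq0_sphere rho0 yr)).
  rewrite /move1 (nrm_onto r0 xr).1 (nrm_onto rho0 yr).1.
  by case: (X p).
have sXP : lift_on X [set: M] X (s \o X).
  move=> p _; split; last exact: sX.
  have [xr yr] := XT p.
  have [sc _] := sP (X p) (conj (neq0_sphere r0 xr) (neq0_sphere rho0 yr)).
  by apply: (@continuous_comp _ _ _ X s p); [exact: Xc | exact: sc].
have idP : lift_on X [set: M] X id by move=> p _; split=> //; exact: cvg_id.
have sK p : s (X p) = p.
  apply: (lift_unique M_hausdorff Xinj sXP idP M_connected _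
    (y := s (X p0)) (z := p)) => //=.
  by rewrite sX.
by move=> E0; rewrite -(sK p0) -(sK p0') E0.
Qed.

End SphereProduct.

Lemma sphereE {R : realType} m (s : R) : 0 <= s ->
  sphere m s = [set v : 'rV[R]_m | dot v v = s ^+ 2].
Proof.
move=> s0; apply/seteqP; split=> v /=; first by move=> <-; rewrite enormK.
by rewrite /sphere /= /enorm => ->; rewrite sqrtr_sqr ger0_norm.
Qed.

Unset Implicit Arguments.

Theorem corollary6 (R : realType) (n k : nat)
  (hn : (3 <= n)%N) (hk2 : (2 <= k)%N) (hkn : (k <= n - 1)%N)
  (M : topologicalType)
  (M_compact : compact [set: M]) (M_hausdorff : hausdorff_space M)
  (M_connected : connected [set: M])
  (A : smooth_atlas R n M)
  (X N : M -> 'rV[R]_(n - k + 1) * 'rV[R]_(k + 1))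
  (hX : immersion_in_cylinder A (Num.sqrt (2 * (k - 1)%N%:R)) X)
  (hN : unit_normal_field A X N)
  (hNout : outward_oriented X N)
  (hmin : f_minimal A X N)
  (hH : forall c u, charts A c -> dom c u ->
     mean_curvature X N c u <= Num.sqrt (2 * (n - k)%N%:R) / 2) :
  range X = sphere (n - k + 1) (Num.sqrt (2 * (n - k)%N%:R)) `*`
            sphere (k + 1) (Num.sqrt (2 * (k - 1)%N%:R)) /\
  ((2 <= n - k)%N -> injective X).
Proof.
have k_gt0 : (0 < k)%N := ltnW hk2.
have nk1 : (1 <= n - k)%N by lia.
set a := (n - k + 1)%N in X N hX hN hNout hmin hH *.
set b := (k + 1)%N in X N hX hN hNout hmin hH *.
set rho := Num.sqrt _ in hX *.
have aE : a%:R - 1 = (n - k)%N%:R :> R by rewrite /a natrD addrK.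
have a2 : (1 < a)%N by rewrite /a; lia.
have b3 : (2 < b)%N by rewrite /b; lia.
have ab : (a + b = n.+2)%N by rewrite /a /b; lia.
have rho0 : 0 < rho by rewrite sqrtr_gt0 mulr_gt0 // ltr0n; lia.
set r := Num.sqrt (2 * (n - k)%N%:R) in hH *.
have r0 : 0 < r by rewrite sqrtr_gt0 mulr_gt0 // ltr0n.
have r2 : r ^+ 2 = 2 * (a%:R - 1) by rewrite sqr_sqrtr ?aE // mulr_ge0 ?ler0n.
have x_sphere p : dot (X p).1 (X p).1 = r ^+ 2.
  rewrite r2; apply: (radius_constant ab a2 rho0 M_connected hX hN hmin hNout).
  by rewrite aE.
have [Xs Xcyl _] := hX.
have Xc : continuous X := smooth_map_is_continuous Xs.
have XT p : sphere_product rho r (X p).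
  by split=> //; have [_ <-] := Xcyl p; rewrite enormK.
have Xinj := locally_injective hX.
have Xopen := locally_open ab rho0 r0 hX hN x_sphere.
have [p0 _] := hNout.
split.
  rewrite (sphere_product_range r0 rho0 M_compact M_hausdorff Xc XT Xinj Xopen a2 b3 p0).
  by rewrite !sphereE ?ltW.
move=> nk2; have a3 : (2 < a)%N by rewrite /a; lia.
exact: (sphere_product_injective r0 rho0 M_compact M_hausdorff Xc XT Xinj Xopen
  M_connected a3 b3).
Qed.
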